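(* Let $k\geq 1$ be an integer. Suppose that the edges of the complete graph $K_n$ are coloured with the colours red and blue, such that the red spanning subgraph is connected. Then the vertices of $K_n$ can be covered by $k$ disjoint red paths and a blue balanced complete $(k+2)$-partite graph that is disjoint from all of these paths.
   Context: The red spanning subgraph is the graph with vertex set $V(K_n)$ whose edges are the red edges. All subgraphs in a cover are pairwise vertex-disjoint, and together their vertex sets are all of $V(K_n)$. Paths are allowed to be empty (no vertices) or to consist of a single vertex; a red path is a path subgraph all of whose edges are red. A balanced complete $r$-partite graph has its vertex set partitioned into $r$ sets $A_1,\dots,A_r$ with $|A_1|=\dots=|A_r|=m$ for some integer $m\ge 0$ ($m=0$, the empty graph, is allowed), with an edge between two vertices if and only if they lie in different sets $A_i$, $A_j$. A blue balanced complete $r$-partite graph in a coloured $K_n$ is a (not necessarily induced) subgraph of this form all of whose edges are blue; there is no restriction on the colours of edges of $K_n$ inside a part. *)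

(* Defs.v *)
From mathcomp Require Import all_boot.

Set Implicit Arguments.
Unset Strict Implicit.
Unset Printing Implicit Defensive.

Variant colour := Red | Blue.

Definition is_red (a : colour) : bool := if a is Red then true else false.
Definition is_blue (a : colour) : bool := if a is Blue then true else false.

(* The vertices of K_n are the elements of 'I_n and its edges are the
   two-element sets [set x; y] with x != y; the values of a colouring on
   other sets are never used. *)
Definition edge_colouring (n : nat) := {set 'I_n} -> colour.

Definition red_edge n (c : edge_colouring n) : rel 'I_n :=
  fun x y => (x != y) && is_red (c [set x; y]).

Definition blue_edge n (c : edge_colouring n) : rel 'I_n :=
  fun x y => (x != y) && is_blue (c [set x; y]).

(* With this convention the graph without vertices is connected. *)
Definition connected_graph (T : finType) (e : rel T) : Prop :=
  forall x y : T, connect e x y.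

(* A path is given by the sequence of its vertices in order; [::] is the empty
   path and [:: x] the path with the single vertex x. *)
Definition path_in (T : eqType) (e : rel T) (s : seq T) : bool :=
  uniq s && sorted e s.

(* A is the family of parts. The subgraph need not be induced: edges of e
   inside a part are allowed. *)
Definition balanced_complete_multipartite_in (T : finType) (e : rel T)
    (r : nat) (A : 'I_r -> {set T}) : Prop :=
  [/\ forall i j : 'I_r, i != j -> [disjoint A i & A j],
      exists m : nat, forall i : 'I_r, #|A i| = m
    & forall i j : 'I_r, i != j -> {in A i & A j, forall x y, e x y}].

(* Main.v *)
Require Import Defs.
From mathcomp Require Import all_boot zify.
From Stdlib Require Import Classical.

Set Implicit Arguments.
Unset Strict Implicit.
Unset Printing Implicit Defensive.

(** A depth-first search of a set of vertices in the red graph is recorded as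
    a word, its tour: a vertex is written when the search enters it and again
    when the search leaves it.  The vertices entered but not yet left at a
    given moment, the stack, form a red path, and two vertices joined by a red
    edge are nested: one of them is entered and left while the other is open.
    Cut a tour into consecutive pieces.  The vertices with both occurrences in
    one piece make a bin; bins of different pieces are joined by blue edges
    only.  Every other vertex is split by some cut, and
    those split vertices entered in one piece form a red path, the link of
    that piece; the last piece has an empty link.  A cut into k + 2 pieces
    whose bins are equally large always exists ([cut_eq_exists]), because the
    bins change by at most one vertex when a cut moves by one letter.

    For the whole graph this gives k + 1 paths, one too many.  So a red path
    K is set aside and only its complement is toured; of the k + 2 paths now
    present, K and the k + 1 links, two links have to be glued to the ends of
    K.  This is possible if K has disjoint sets A and B outside it, each a
    union of components of the complement of K, such that the search of A can
    always be started next to the first end of K and the search of B next to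
    the last end, and if one cut falls inside the tour of A and another one
    inside the tour of B: the stacks at these cuts then extend K
    ([joined_paths]).

    The path K, the sets A and B and a number c are found in [core_path]:
    among the vertex sets S spanned by a red path take one for which the
    largest component of the complement, then the number of vertices in the
    components of that largest size c, then S itself is smallest.  No path
    through S can then be extended or rerouted into a component of size c,
    so by [ends_separated] the two ends of the path see different parts of
    the complement, and since giving up an end must create a component of
    size at least c, there is room for A and B with c to 2c - 1 vertices each
    and, next to them, a component of size c.  The other components of the
    complement of K have at most c vertices.

    It remains to write the tours of A, of B and of the other components in
    an order for which the cuts fall inside A and B ([arrange_exists]).  Start
    with A and B adjacent and the other components distributed evenly to the
    left of A and to the right of B.  While the first cut comes before A, or
    the last cut after B, move the neighbouring component to the place
    between A and B.  The value of the cut changes so little in each move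
    ([swap_bounds]) that the cuts cannot jump over A and B. *)

(** * Words and cuts into equal pieces *)

Section Strings.

Variable T : finType.
Implicit Types (n v : nat) (z : T) (b s t W A B E : seq T) (ss tt : seq (seq T)).

(** Words are read as records of searches: the first occurrence of a letter
    opens it and the second one closes it.  [pairs] is the size of the bin
    that a piece of a tour contributes. *)
Definition occ z s := count_mem z s.
Definition inner s : {set T} := [set z | 1 < occ z s].
Definition pairs s := #|inner s|.
Definition doubled s := forall z, occ z s <= 2.
Definition paired s := forall z, z \in s -> 1 < occ z s.

Lemma occ_cat z s t : occ z (s ++ t) = occ z s + occ z t.
Proof. exact: count_cat. Qed.

Lemma occ_cons z y s : occ z (y :: s) = (y == z) + occ z s.
Proof. by []. Qed.

Lemma occ_rcons z y s : occ z (rcons s y) = (y == z) + occ z s.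
Proof. by rewrite -cats1 occ_cat /occ /= addn0 addnC. Qed.

Lemma occ_rev z s : occ z (rev s) = occ z s.
Proof. exact: count_rev. Qed.

Lemma mem_occ z s : (z \in s) = (0 < occ z s).
Proof. by rewrite -has_pred1 has_count. Qed.

Lemma cat_cases (A B s t : seq T) : A ++ B = s ++ t ->
  (exists u, s = A ++ u /\ B = u ++ t) \/ (exists u, A = s ++ u /\ t = u ++ B).
Proof.
elim: A s => [|a A IH] [|b s] /=.
- by move=> ->; left; exists [::].
- by move=> ->; left; exists (b :: s).
- by move=> <-; right; exists (a :: A).
by case=> -> /IH[[u [-> ->]] | [u [-> ->]]]; [left | right]; exists u.
Qed.

Lemma inner_sub A s B : inner s \subset inner (A ++ s ++ B).
Proof. by apply/subsetP=> z; rewrite !inE !occ_cat; lia. Qed.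

Lemma pairs_sub A s B : pairs s <= pairs (A ++ s ++ B).
Proof. exact/subset_leq_card/inner_sub. Qed.

Lemma pairs_nil : pairs [::] = 0.
Proof. by apply/eqP; rewrite cards_eq0; apply/eqP/setP=> z; rewrite !inE. Qed.

Lemma pairs_rev s : pairs (rev s) = pairs s.
Proof. by rewrite /pairs; congr #|pred_of_set _|; apply/setP=> z; rewrite !inE occ_rev. Qed.

Lemma doubled_cat A s B : doubled (A ++ s ++ B) -> doubled s.
Proof. by move=> dW z; have := dW z; rewrite !occ_cat; lia. Qed.

Lemma pairs_cat s t : doubled (s ++ t) -> pairs s + pairs t <= pairs (s ++ t).
Proof.
move=> d; rewrite /pairs -cardsUI (_ : inner s :&: inner t = set0) ?cards0 ?addn0.
  by apply/subset_leq_card/subsetP=> z; rewrite !inE occ_cat; lia.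
by apply/setP=> z; have := d z; rewrite !inE occ_cat; lia.
Qed.

Lemma pairs_cat_paired s t :
  doubled (s ++ t) -> paired s -> pairs (s ++ t) = pairs s + pairs t.
Proof.
move=> d cl; apply/eqP; rewrite eqn_leq pairs_cat // andbT /pairs.
apply: leq_trans (leq_card_setU _ _); apply/subset_leq_card/subsetP=> z.
by rewrite !inE occ_cat; have := cl z; rewrite mem_occ; lia.
Qed.

Lemma paired_rev s : paired s -> paired (rev s).
Proof. by move=> cl z; rewrite mem_rev occ_rev; apply: cl. Qed.

Lemma paired_cat s t : paired s -> paired t -> paired (s ++ t).
Proof. by move=> cs ct z; rewrite mem_cat occ_cat => /orP[/cs | /ct]; lia. Qed.

Lemma paired_flatten ss : {in ss, forall s, paired s} -> paired (flatten ss).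
Proof.
elim: ss => [|s ss IH] cl //=; apply: paired_cat; first by apply: cl; apply: mem_head.
by apply: IH => t t_ss; apply: cl; rewrite inE t_ss orbT.
Qed.

Lemma doubled_rev s : doubled s -> doubled (rev s).
Proof. by move=> d z; rewrite occ_rev. Qed.

Lemma doubled_perm s t : perm_eq s t -> doubled s -> doubled t.
Proof. by move=> /permP st d z; rewrite /occ -st; apply: d. Qed.

(** The last letter of a word in which every letter occurs twice closes a
    pair, which a proper prefix lacks. *)
Lemma pairs_prefix s t : doubled (s ++ t) -> paired (s ++ t) -> t != [::] ->
  pairs s < pairs (s ++ t).
Proof.
case: t => // z t d cl _; apply: proper_card; apply/properP; split.
  exact: (inner_sub [::]).
exists z; first by rewrite inE cl // mem_cat mem_head orbT.
by have := d z; rewrite !inE occ_cat occ_cons eqxx; lia.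
Qed.

Lemma pairs_suffix s t : doubled (s ++ t) -> paired (s ++ t) -> s != [::] ->
  pairs t < pairs (s ++ t).
Proof.
move=> d cl s0; rewrite -(pairs_rev t) -(pairs_rev (s ++ t)) rev_cat.
apply: pairs_prefix; rewrite -?rev_cat; [exact: doubled_rev | exact: paired_rev |].
by rewrite -size_eq0 size_rev size_eq0.
Qed.

Lemma pairs_cons z s : pairs (z :: s) <= (pairs s).+1.
Proof.
rewrite /pairs -add1n -(cards1 z); apply: leq_trans (leq_card_setU _ _).
by apply/subset_leq_card/subsetP=> y; rewrite !inE occ_cons [z == y]eq_sym; case: eqVneq.
Qed.

Lemma pairs_cons_new z s : z \notin s -> pairs (z :: s) = pairs s.
Proof.
move=> zs; rewrite /pairs; congr #|pred_of_set _|; apply/setP=> y; rewrite !inE occ_cons.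
by case: eqVneq => [<-|] //=; move: zs; rewrite mem_occ; case: occ.
Qed.

Lemma pairs_rcons s z : pairs (rcons s z) = pairs (z :: rev s).
Proof. by rewrite -pairs_rev rev_rcons. Qed.

Definition cut_le n v W :=
  exists ss, [/\ size ss = n, flatten ss = W & all (fun s => pairs s <= v) ss].
Definition cut_ge n v W :=
  exists ss, [/\ size ss = n, flatten ss = W & all (fun s => v <= pairs s) ss].
Definition cut_eq n v W :=
  exists ss, [/\ size ss = n, flatten ss = W & all (fun s => pairs s == v) ss].

Lemma cut_eq_le n v W : cut_eq n v W -> cut_le n v W.
Proof.
by case=> ss [sz fl eqs]; exists ss; split=> //; apply: sub_all eqs => s /eqP->.
Qed.

Lemma cut_eq_ge n v W : cut_eq n v W -> cut_ge n v W.
Proof.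
by case=> ss [sz fl eqs]; exists ss; split=> //; apply: sub_all eqs => s /eqP->.
Qed.

(** Enlarging the first and the last piece only adds pairs. *)
Lemma cut_ge_ext n v A W B : 0 < n -> cut_ge n v W -> cut_ge n v (A ++ W ++ B).
Proof.
case: n => // n _ [[|s ss] [] //= [sz] fl /andP[vs]].
have vAs : v <= pairs (A ++ s) by rewrite (leq_trans vs) // -[s in A ++ s]cats0 pairs_sub.
case/lastP: ss sz fl => [|ss t] sz fl.
  exists [:: A ++ s ++ B]; split=> //=; first by rewrite -sz.
    by rewrite -fl /= !cats0.
  by rewrite catA (leq_trans vAs) //; apply: (pairs_sub [::]).
rewrite all_rcons => /andP[vt ge_ss]; exists ((A ++ s) :: rcons ss (t ++ B)); split=> /=.
- by rewrite -sz !size_rcons.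
- by rewrite -fl /= !flatten_rcons !catA.
by rewrite vAs all_rcons ge_ss (leq_trans vt) //; apply: (pairs_sub [::]).
Qed.

(** Two cuts of one word into equally many pieces: a piece of the second one
    lies inside a piece of the first one.  The induction drops the first piece
    of both as long as the second cut stays ahead of the first one, and [A] is
    the part of the word by which it is ahead. *)
Lemma cut_le_ge n v v' W : 0 < n -> cut_le n v W -> cut_ge n v' W -> v' <= v.
Proof.
move=> n_gt0 [ss [sz fl le_ss]] [tt [sz' fl' ge_tt]].
have: size ss <= size tt by rewrite sz sz'.
have: exists A, flatten ss = A ++ flatten tt by exists [::]; rewrite fl fl'.
have: tt != [::] by rewrite -size_eq0 sz'; case: (n) n_gt0.
move=> tt0 [A]; move: tt0 => {sz sz' fl fl' n_gt0}.
elim: ss A tt le_ss ge_tt => [|s ss IH] A [|t tt] //=.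
  by move=> _ /andP[vt _] _; case: A t vt => [|? ?] [|? ?] //; rewrite pairs_nil leqn0 => /eqP->.
move=> /andP[vs le_ss] /andP[vt ge_tt] _.
rewrite catA => /cat_cases[[u [def_At fl]] | [u [def_s _]]] sz; last first.
  by apply: leq_trans vt (leq_trans _ vs); rewrite def_s -catA pairs_sub.
case: tt ge_tt fl sz IH => [|t' tt] ge_tt fl sz IH.
  case: ss {le_ss IH} fl sz => // /esym; rewrite cats0 => u0 _.
  apply: leq_trans vt (leq_trans _ vs); move: def_At; rewrite u0 cats0 => <-.
  by rewrite -[t in A ++ t]cats0 pairs_sub.
exact: IH fl sz.
Qed.

Lemma cut_le_ge_infix n v v' A W B : 0 < n ->
  cut_le n v (A ++ W ++ B) -> cut_ge n v' W -> v' <= v.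
Proof. by move=> n0 le_v /(cut_ge_ext A B n0); apply: cut_le_ge. Qed.

(** A discrete intermediate value argument.  Cut off a first piece [A] and cut
    the rest [B] equally with value [h]; move letters one by one from [B] to
    [A] until [pairs A] reaches [h].  One letter changes [pairs A] and [h] by
    at most one each, and never both: the letter would have its other
    occurrence in [A] and in [B].  So [pairs A] cannot pass [h] without
    meeting it. *)
Lemma cut_eq_exists n W : doubled W -> exists v, cut_eq n.+1 v W.
Proof.
elim: n W => [|n IHn] W dW.
  by exists (pairs W), [:: W]; rewrite /= cats0 eqxx.
suff shift B A : doubled (A ++ B) -> (exists2 h, cut_eq n.+1 h B & pairs A <= h) ->
    exists v, cut_eq n.+2 v (A ++ B).
  by apply: (shift W [::]) => //; have [h] := IHn W dW; exists h; rewrite ?pairs_nil.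
elim: B A => [|z B IHB] A dAB [h eq_h].
  rewrite leq_eqVlt => /orP[/eqP Ah | lt_h].
    by case: eq_h => ss [sz fl eq_ss]; exists h, (A :: ss); rewrite /= sz fl Ah eqxx.
  case: eq_h => [[|s ss] [] //= _ fl /andP[/eqP sh _]].
  have s0 : s = [::] by case: s fl {sh}.
  by rewrite -sh s0 pairs_nil in lt_h.
rewrite leq_eqVlt => /orP[/eqP Ah | lt_h].
  by case: eq_h => ss [sz fl eq_ss]; exists h, (A :: ss); rewrite /= sz fl Ah eqxx.
rewrite -cat_rcons; have dAB' : doubled (rcons A z ++ B) by rewrite cat_rcons.
apply: IHB => //; have [|h1 eq_h1] := IHn B.
  by apply: (doubled_cat (A := rcons A z) (B := [::])); rewrite cats0.
exists h1 => //; have [ss [sz fl eq_ss]] := eq_h1.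
case: ss sz fl eq_ss => // s ss [sz] fl /= /andP[/eqP sh1 eq_ss].
have le_h v : h1 <= v -> pairs (z :: s) <= v -> h <= v.
  move=> le_v le_zs; apply: cut_le_ge (cut_eq_ge eq_h) => //.
  exists ((z :: s) :: ss); rewrite /= sz -fl le_zs; split=> //.
  by apply: sub_all eq_ss => t /eqP->.
rewrite pairs_rcons; have [zA | zA] := boolP (z \in A).
  have zs : z \notin s.
    apply/negP=> zs; have := dAB z; rewrite -fl !occ_cat occ_cons eqxx occ_cat.
    by move: zA zs; rewrite !mem_occ; lia.
  apply: leq_trans (pairs_cons _ _) _; rewrite pairs_rev.
  by apply: leq_trans lt_h _; apply: le_h; rewrite ?pairs_cons_new ?sh1.
rewrite pairs_cons_new ?mem_rev // pairs_rev -ltnS; apply: leq_trans lt_h _.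
by apply: le_h => //; rewrite (leq_trans (pairs_cons _ _)) ?sh1.
Qed.

Lemma cut_eq_rev n v W : cut_eq n v W -> cut_eq n v (rev W).
Proof.
case=> ss [sz fl eq_ss]; exists (rev (map rev ss)).
rewrite size_rev size_map -rev_flatten fl all_rev all_map; split=> //.
by apply: sub_all eq_ss => s /=; rewrite pairs_rev.
Qed.

Lemma pairs_cat_disjoint s t :
  {in s, forall z, z \notin t} -> pairs (s ++ t) = pairs s + pairs t.
Proof.
move=> st; rewrite /pairs -cardsUI (_ : inner s :&: inner t = set0) ?cards0 ?addn0.
  congr #|pred_of_set _|; apply/setP=> z; rewrite !inE occ_cat.
  by have := st z; rewrite !mem_occ; lia.
by apply/setP=> z; have := st z; rewrite !inE !mem_occ; lia.
Qed.

Lemma paired_disjoint s t : doubled (s ++ t) -> paired s -> {in s, forall z, z \notin t}.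
Proof.
move=> d cl z zs; have := cl z zs; have := d z.
by rewrite occ_cat mem_occ; lia.
Qed.

(** A prefix [P] that shares no letter with the rest may be replaced by [X]
    with at least as many pairs.  No proper prefix of [P] reaches [v], so the
    first piece contains all of [P], and the exchange takes place inside it. *)
Lemma cut_ge_replace n v P X E :
    cut_ge n.+1 v (P ++ E) -> doubled (X ++ E) -> {in P, forall z, z \notin E} ->
    pairs P <= pairs X ->
    (forall p q, P = p ++ q -> q != [::] -> pairs p < v) ->
  cut_ge n.+1 v (X ++ E).
Proof.
case=> [[|s ss] [] //= [sz] fl /andP[vs ge_ss]] dXE PE le_PX short.
case/cat_cases: fl => [[u [def_P fl]] | [u [def_s def_E]]].
  have u0 : u = [::].
    apply/eqP/negPn/negP=> u0; have := short s u def_P u0.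
    by rewrite ltnNge vs.
  exists (X :: ss); rewrite /= sz fl u0 (leq_trans vs) //.
  by rewrite def_P u0 cats0 in le_PX.
exists ((X ++ u) :: ss); rewrite /= sz def_E catA ge_ss andbT; split=> //.
apply: leq_trans vs _; rewrite def_s pairs_cat_disjoint.
  apply: leq_trans (pairs_cat _); first by rewrite leq_add2r.
  by apply: (doubled_cat (A := [::]) (B := flatten ss)); rewrite /= -catA -def_E.
by move=> z /PE; rewrite def_E mem_cat; case: (z \in u).
Qed.

(** All of [Y] can be put into the single piece that contains the place of
    insertion. *)
Lemma cut_le_insert n v A Y B :
    cut_le n.+1 v (A ++ B) -> {in Y, forall z, z \notin A ++ B} ->
  cut_le n.+1 (v + pairs Y) (A ++ Y ++ B).
Proof.
elim: n A => [|n IHn] A [[|s ss] [] //= [sz] fl /andP[sv le_ss]] YAB.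
  exists [:: A ++ Y ++ B]; rewrite /= cats0 andbT; split=> //.
  case: ss sz {le_ss} fl => // _; rewrite cats0 => def_s; rewrite {s}def_s in sv.
  apply: leq_trans (_ : pairs (Y ++ (A ++ B)) <= _).
    by rewrite /pairs; apply/subset_leq_card/subsetP=> z; rewrite !inE !occ_cat; lia.
  by rewrite pairs_cat_disjoint // addnC leq_add2r.
case/cat_cases: fl => [[u [def_A fl]] | [u [def_s def_B]]].
  have [|z /YAB|tt [sz' fl' le_tt]] := IHn u.
  - by exists ss; rewrite sz -fl.
  - by rewrite def_A -catA mem_cat negb_or => /andP[].
  exists (s :: tt); rewrite /= sz' fl' def_A -catA le_tt andbT; split=> //.
  exact: leq_trans sv (leq_addr _ _).
exists ((A ++ Y ++ u) :: ss); rewrite /= sz def_B -!catA; split=> //.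
apply/andP; split; last by apply: sub_all le_ss => t /leq_trans-> //; apply: leq_addr.
apply: leq_trans (_ : pairs (Y ++ (A ++ u)) <= _).
  by rewrite /pairs; apply/subset_leq_card/subsetP=> z; rewrite !inE !occ_cat; lia.
rewrite -def_s pairs_cat_disjoint ?[v + _]addnC ?leq_add2l // => z /YAB.
by rewrite def_s def_B catA mem_cat negb_or => /andP[].
Qed.

Lemma cut_le_filter n v (a : pred T) W : cut_le n v W -> cut_le n v (filter a W).
Proof.
case=> ss [sz fl le_ss]; exists (map (filter a) ss); rewrite size_map -filter_flatten fl.
split=> //; rewrite all_map; apply: sub_all le_ss => s /=; apply: leq_trans.
apply/subset_leq_card/subsetP=> z; rewrite !inE /occ count_filter => /leq_trans-> //.
by apply: sub_count => y /andP[].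
Qed.

(** The effect of moving a block [Y] to the other side of a larger block [X]
    on the value of an equal cut, when the first piece ends before [X]
    begins. *)
Section Swap.

Variables (n v v' : nat) (L Y X E : seq T).
Hypotheses (dLYXE : doubled (L ++ Y ++ X ++ E)).
Hypotheses (clL : paired L) (clY : paired Y) (clX : paired X).
Hypotheses (Y0 : Y != [::]) (le_YX : pairs Y <= pairs X).
Hypotheses (eq_v : cut_eq n.+2 v (L ++ Y ++ X ++ E)).
Hypotheses (eq_v' : cut_eq n.+2 v' (L ++ X ++ Y ++ E)).
Hypothesis (lt_v : v < pairs L + pairs Y).

Let dLXYE : doubled (L ++ X ++ Y ++ E).
Proof.
by apply: doubled_perm dLYXE; rewrite perm_cat2l perm_catCA.
Qed.

Let dLY : doubled (L ++ Y).
Proof. by apply: (doubled_cat (A := [::]) (B := X ++ E)); rewrite /= -catA. Qed.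

Let dLX : doubled (L ++ X).
Proof. by apply: (doubled_cat (A := [::]) (B := Y ++ E)); rewrite /= -catA. Qed.

Let dXE : doubled (X ++ E).
Proof. by apply: (doubled_cat (A := L ++ Y) (B := [::])); rewrite /= cats0 -catA. Qed.

Let dYE : doubled (Y ++ E).
Proof. by apply: (doubled_cat (A := L ++ X) (B := [::])); rewrite /= cats0 -catA. Qed.

Let Y_gt0 : 0 < pairs Y.
Proof.
rewrite -pairs_nil; apply: (pairs_prefix (s := [::])) => //.
exact: doubled_cat dLYXE.
Qed.

(** The first of the [n.+2] pieces lies inside [L ++ Y], so the other [n.+1]
    pieces have to cover [X ++ E]. *)
Let rest_le v1 : cut_ge n.+1 v1 (X ++ E) -> v1 <= v.
Proof.
have [[|s ss] [] //= [sz] fl /andP[/eqP sv eq_ss]] := eq_v.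
move: fl; rewrite [RHS]catA => /cat_cases[[u [def_LY fl]] | [u [def_s _]]].
  apply: (cut_le_ge_infix (A := u) (B := [::])) => //; rewrite cats0 -fl.
  by exists ss; split=> //; apply: sub_all eq_ss => t /eqP->.
have := pairs_sub [::] (L ++ Y) u; rewrite /= -def_s sv pairs_cat_paired //.
by move: lt_v; lia.
Qed.

(** Otherwise the first piece of the new word would contain [L ++ X], the
    other pieces would cut [Y ++ E], and [X] in place of [Y] would give a cut
    of [X ++ E] that contradicts [rest_le]. *)
Lemma swap_lt_right : v' < pairs L + pairs X.
Proof.
rewrite ltnNge; apply/negP=> ge_v'.
suff : v' <= v by move: lt_v ge_v' le_YX; lia.
apply: rest_le; apply: (@cut_ge_replace _ _ Y) => //; last first.
- move=> p q def_Y q0; apply: leq_trans (_ : pairs Y <= _).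
    by rewrite def_Y; apply: pairs_prefix => //; rewrite -def_Y //; apply: (doubled_cat dLYXE).
  by move: ge_v' le_YX; lia.
- exact: paired_disjoint.
have [[|s ss] [] //= [sz] fl /andP[/eqP sv eq_ss]] := eq_v'.
have ge_ss : cut_ge n.+1 v' (flatten ss).
  by exists ss; split=> //; apply: sub_all eq_ss => t /eqP->.
move: fl; rewrite [RHS]catA => /cat_cases[[u [def_LX fl]] | [u [def_s ->]]].
  have u0 : u = [::].
    apply/eqP/negPn/negP=> u0; have := pairs_prefix _ _ u0; move: ge_v'.
    rewrite -pairs_cat_paired // -sv def_LX leqNgt => /negP ge_v' lt; apply: ge_v'.
    by apply: lt; rewrite -def_LX //; apply: paired_cat.
  by rewrite fl u0 in ge_ss.
by rewrite -[flatten ss]cats0; apply: cut_ge_ext => //; rewrite cats0.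
Qed.

(** Otherwise the first piece of the new word would contain [L] and a prefix
    [X1] of [X] with at least [pairs Y] pairs.  What remains after it, the end
    of [X] followed by [Y], has no more pairs than [X], so putting [X] in its
    place contradicts [rest_le] again. *)
Lemma swap_lt_left : v' < pairs L + pairs Y \/ v' < pairs X.
Proof.
case: (ltnP v' (pairs L + pairs Y)) => [|geY]; first by left.
case: (ltnP v' (pairs X)) => [|geX]; first by right.
suff : v' <= v by move: lt_v geY; lia.
apply: rest_le; have lt_v' := swap_lt_right.
have [[|s ss] [] //= [sz] fl /andP[/eqP sv eq_ss]] := eq_v'.
have ge_ss : cut_ge n.+1 v' (flatten ss).
  by exists ss; split=> //; apply: sub_all eq_ss => t /eqP->.
move: fl; rewrite [RHS]catA => /cat_cases[[u [def_LX fl]] | [u [def_s _]]]; last first.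
  have := pairs_sub [::] (L ++ X) u; rewrite /= -def_s sv pairs_cat_paired //.
  by move: lt_v'; lia.
case/esym/cat_cases: def_LX => [[w [def_L _]] | [X1 [def_s def_X]]].
  have := pairs_sub [::] s w; rewrite /= -def_L sv; move: geY Y_gt0; lia.
have pX1 : pairs Y <= pairs X1.
  have dLX1 : doubled (L ++ X1).
    by apply: (doubled_cat (A := [::]) (B := u)); rewrite /= -catA -def_X.
  by move: sv; rewrite def_s pairs_cat_paired //; move: geY; lia.
have dX : doubled X by apply: (doubled_cat (A := L) (B := [::])); rewrite cats0.
have pX : pairs X1 + pairs u <= pairs X by rewrite def_X pairs_cat // -def_X.
have disjX z : z \in X -> z \notin Y ++ E.
  apply: paired_disjoint => //; apply: (doubled_cat (A := L) (B := [::])).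
  by rewrite cats0.
have disj_u z : z \in u -> z \notin Y ++ E.
  by move=> zu; apply: disjX; rewrite def_X mem_cat zu orbT.
have pu t : {subset t <= Y} -> pairs (u ++ t) = pairs u + pairs t.
  move=> tY; apply: pairs_cat_disjoint => z /disj_u; rewrite mem_cat negb_or => /andP[zY _].
  by apply: contra zY; apply: tY.
rewrite fl catA in ge_ss; apply: cut_ge_replace ge_ss _ _ _ _ => //.
- move=> z; rewrite mem_cat => /orP[/disj_u | zY].
    by rewrite mem_cat negb_or => /andP[].
  by apply: paired_disjoint zY.
- by rewrite pu //; move: pX pX1; lia.
move=> p q /esym/cat_cases[[w [def_u _]] | [w [-> def_Y]]] q0.
  have := pairs_sub [::] p w; rewrite /= -def_u; move: pX pX1 Y_gt0 geX; lia.
have : pairs w < pairs Y.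
  by rewrite def_Y; apply: pairs_prefix => //; rewrite -def_Y //; apply: (doubled_cat dLYXE).
rewrite pu; first by move: pX pX1 geX; lia.
by move=> z zw; rewrite def_Y mem_cat zw.
Qed.

(** Erase [Y] from the old word and insert it at its new place: erasing does
    not increase the pieces and inserting adds at most [pairs Y]. *)
Lemma swap_le_add : v' <= v + pairs Y.
Proof.
have dY z : z \in Y -> z \notin L ++ X ++ E.
  move=> zY; have := dLYXE z; have := clY zY; rewrite !mem_cat !mem_occ !occ_cat; lia.
have filtY t : {in t, forall z, z \notin Y} -> filter [predC Y] t = t.
  by move=> tY; apply/all_filterP/allP=> z /tY.
have le_v : cut_le n.+2 v (L ++ X ++ E).
  have := cut_le_filter [predC Y] (cut_eq_le eq_v).
  rewrite [in X in cut_le _ _ X]filter_cat [in X in cut_le _ _ X]filter_cat.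
  rewrite (_ : [seq z <- Y | _] = [::]); last first.
    by apply/eqP; rewrite -(negbK (_ == _)) -has_filter -all_predC; apply/allP=> z /=; rewrite negbK.
  rewrite filtY ?filtY //= => z zt; apply/negP=> /dY; rewrite !mem_cat ?zt ?orbT //.
  by rewrite -mem_cat zt orbT.
apply: cut_le_ge (cut_eq_ge eq_v') => //.
rewrite catA; apply: cut_le_insert; first by rewrite -catA.
by move=> z /dY; rewrite -catA.
Qed.

Lemma swap_bounds :
  [/\ v' < pairs L + pairs X, v' < pairs L + pairs Y \/ v' < pairs X & v' <= v + pairs Y].
Proof. by split; [apply: swap_lt_right | apply: swap_lt_left | apply: swap_le_add]. Qed.

End Swap.

Lemma swap_bounds_right n v v' E X Y R :
    doubled (E ++ X ++ Y ++ R) -> paired R -> paired Y -> paired X ->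
    Y != [::] -> pairs Y <= pairs X ->
    cut_eq n.+2 v (E ++ X ++ Y ++ R) -> cut_eq n.+2 v' (E ++ Y ++ X ++ R) ->
    v < pairs R + pairs Y ->
  [/\ v' < pairs R + pairs X, v' < pairs R + pairs Y \/ v' < pairs X & v' <= v + pairs Y].
Proof.
move=> dW clR clY clX Y0 le_YX /cut_eq_rev eq_v /cut_eq_rev eq_v' lt_v.
have def_rev (P Q : seq T) : rev (E ++ P ++ Q ++ R) = rev R ++ rev Q ++ rev P ++ rev E.
  by rewrite !rev_cat -!catA.
rewrite def_rev in eq_v; rewrite def_rev in eq_v'.
have d' : doubled (rev R ++ rev Y ++ rev X ++ rev E) by rewrite -def_rev; apply: doubled_rev.
have Y0' : rev Y != [::] by rewrite -size_eq0 size_rev size_eq0.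
rewrite -(pairs_rev Y) -(pairs_rev X) in le_YX; rewrite -(pairs_rev Y) -(pairs_rev R) in lt_v.
rewrite -(pairs_rev Y) -(pairs_rev X) -(pairs_rev R).
have [[clR' clY'] clX'] := (paired_rev clR, paired_rev clY, paired_rev clX).
exact: swap_bounds d' clR' clY' clX' Y0' le_YX eq_v eq_v' lt_v.
Qed.

Lemma pairs_flatten ss :
  doubled (flatten ss) -> {in ss, forall s, paired s} ->
  pairs (flatten ss) = \sum_(s <- ss) pairs s.
Proof.
elim: ss => [|s ss IH] /= d cl; first by rewrite big_nil pairs_nil.
have cls := cl _ (mem_head _ _).
rewrite big_cons pairs_cat_paired // IH // => [|t t_ss].
  by apply: (doubled_cat (A := s) (B := [::])); rewrite cats0.
by apply: cl; rewrite inE t_ss orbT.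
Qed.

Lemma cut_ge_total n v W : doubled W -> cut_ge n v W -> n * v <= pairs W.
Proof.
move=> dW [ss [<- def_W ge_ss]]; move: dW; rewrite -{W}def_W.
elim: ss ge_ss => [|s ss IH] //= /andP[vs ge_ss] dW.
have dss : doubled (flatten ss) by apply: (doubled_cat (A := s) (B := [::])); rewrite cats0.
by apply: leq_trans (pairs_cat dW); rewrite mulSn leq_add // IH.
Qed.

(** The blocks are distributed one by one, each to the side that is smaller
    at the time. *)
Lemma split_sum (bs : seq (seq T)) (c x y : nat) :
    {in bs, forall b, pairs b <= c} -> x <= y + c -> y <= x + c ->
  exists L R : seq (seq T), [/\ perm_eq (L ++ R) bs,
    x + \sum_(b <- L) pairs b <= y + \sum_(b <- R) pairs b + c
  & y + \sum_(b <- R) pairs b <= x + \sum_(b <- L) pairs b + c].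
Proof.
elim: bs x y => [|b bs IH] x y le_c xy yx.
  by exists [::], [::]; rewrite big_nil !addn0.
have le_b := le_c b (mem_head _ _).
have le_c' : {in bs, forall b, pairs b <= c} by move=> d d_bs; apply: le_c; rewrite inE d_bs orbT.
have [le_xy | /ltnW le_yx] := leqP x y.
  have [||L [R [p1 p2 p3]]] := IH (x + pairs b) y le_c'; try by lia.
  by exists (b :: L), R; rewrite /= perm_cons p1 !big_cons !addnA.
have [||L [R [p1 p2 p3]]] := IH x (y + pairs b) le_c'; try by lia.
exists L, (b :: R); rewrite !big_cons !addnA; split=> //.
by rewrite perm_catC /= perm_cons perm_catC.
Qed.

Section Arrange.

Variables (c : nat) (A B : seq T) (bs : seq (seq T)).
Hypotheses (dF : doubled (A ++ B ++ flatten bs)).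
Hypotheses (clA : paired A) (clB : paired B).
Hypotheses (cl_bs : {in bs, forall b, paired b}).
Hypotheses (bs0 : {in bs, forall b, b != [::]}).
Hypotheses (bs_le : {in bs, forall b, pairs b <= c}).
Hypotheses (cA : c <= pairs A) (cB : c <= pairs B).

Implicit Types (L M R : seq (seq T)).

Definition line L M R := flatten L ++ A ++ flatten M ++ B ++ flatten R.

(** What the rearrangement preserves.  By the first two conditions, a first
    piece does not contain all of the left blocks and [A], nor a last piece
    all of the right blocks and [B]; the other two bound each side by
    the other one, which keeps the second condition when a block leaves the
    left side and the first one when a block leaves the right side. *)
Definition near_balance v L R :=
  [/\ v < pairs (flatten L) + pairs A, v < pairs (flatten R) + pairs B,
      pairs (flatten L) <= pairs (flatten R) + pairs B
    & pairs (flatten R) <= pairs (flatten L) + pairs A].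

Lemma line_perm L M R : perm_eq (L ++ M ++ R) bs -> perm_eq (line L M R) (A ++ B ++ flatten bs).
Proof.
move/perm_flatten; rewrite !flatten_cat => p; rewrite /line.
rewrite perm_catCA perm_cat2l [X in perm_eq X _]catA perm_catCA perm_cat2l.
by rewrite -catA.
Qed.

Lemma doubled_line L M R : perm_eq (L ++ M ++ R) bs -> doubled (line L M R).
Proof. by move/line_perm => p; apply: doubled_perm dF; rewrite perm_sym. Qed.

(** If the first cut comes before [A], or the last one after [B], then the
    larger side has more than [v] pairs; its block next to [A] or [B] is moved
    between them.  The number of blocks outside decreases, so this ends. *)
Lemma arrange n L M R v :
    perm_eq (L ++ M ++ R) bs -> cut_eq n.+2 v (line L M R) -> near_balance v L R ->
  exists L' M' R' v',
   [/\ perm_eq (L' ++ M' ++ R') bs, cut_eq n.+2 v' (line L' M' R'), near_balance v' L' R',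
       pairs (flatten L') <= v' \/ v' < pairs A & pairs (flatten R') <= v' \/ v' < pairs B].
Proof.
have [m] := ubnP (size L + size R); elim: m L M R v => // m IHm L M R v le_m pbs eq_v nb.
have mem_bs b : b \in L ++ M ++ R -> b \in bs by rewrite (perm_mem pbs).
have clL : paired (flatten L).
  by apply: paired_flatten => b bL; apply/cl_bs/mem_bs; rewrite mem_cat bL.
have clR : paired (flatten R).
  by apply: paired_flatten => b bR; apply/cl_bs/mem_bs; rewrite !mem_cat bR !orbT.
have dW := doubled_line pbs; have [ltA ltB leLR leRL] := nb.
have [/andP[/orP savedA /orP savedB] | unsaved] :=
  boolP (((pairs (flatten L) <= v) || (v < pairs A)) &&
         ((pairs (flatten R) <= v) || (v < pairs B))).
  by exists L, M, R, v.
have [leRL' | ltLR'] := leqP (pairs (flatten R)) (pairs (flatten L)).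
  have lt_vL : v < pairs (flatten L) by move: unsaved leRL'; lia.
  case/lastP: L => [|L b] in pbs eq_v ltA ltB leLR leRL unsaved leRL' lt_vL mem_bs clL dW le_m {nb} *.
    by rewrite pairs_nil in lt_vL.
  have b_bs : b \in bs by apply: mem_bs; rewrite mem_cat mem_rcons mem_head.
  have pbs' : perm_eq (L ++ (b :: M) ++ R) bs by rewrite -cat_rcons in pbs *.
  rewrite flatten_rcons in clL; rewrite /line flatten_rcons -catA in eq_v dW.
  have clL1 : paired (flatten L).
    apply: paired_flatten => d dL; apply/cl_bs/mem_bs.
    by rewrite mem_cat mem_rcons inE dL orbT.
  have pL : pairs (flatten (rcons L b)) = pairs (flatten L) + pairs b.
    rewrite flatten_rcons pairs_cat_paired //.
    by apply: (doubled_cat (A := [::])); rewrite /= -catA; exact: dW.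
  rewrite pL in ltA leLR leRL leRL' lt_vL unsaved.
  have [v' eq_v'] := cut_eq_exists n.+1 (doubled_line pbs').
  have le_bc := bs_le b_bs; have le_bA := leq_trans le_bc cA.
  have le_bB := leq_trans le_bc cB.
  have eq_v'2 : cut_eq n.+2 v' (flatten L ++ A ++ b ++ flatten M ++ B ++ flatten R).
    by move: eq_v'; rewrite /line /= -!catA.
  have [lt1 lt2 lt3] :=
    swap_bounds dW clL1 (cl_bs b_bs) clA (bs0 b_bs) le_bA eq_v eq_v'2 lt_vL.
  apply: (IHm L (b :: M) R v') => //; first by rewrite size_rcons in le_m; lia.
  by split; lia.
have lt_vR : v < pairs (flatten R) by move: unsaved ltLR'; lia.
case: R => [|b R] in pbs eq_v ltA ltB leLR leRL unsaved ltLR' lt_vR mem_bs clR dW le_m {nb} *.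
  by rewrite pairs_nil in lt_vR.
have b_bs : b \in bs by apply: mem_bs; rewrite !mem_cat mem_head !orbT.
have pbs' : perm_eq (L ++ rcons M b ++ R) bs by rewrite cat_rcons.
rewrite /line /= in eq_v dW.
have clR1 : paired (flatten R).
  by apply: paired_flatten => d dR; apply/cl_bs/mem_bs; rewrite !mem_cat inE dR !orbT.
have pR : pairs (flatten (b :: R)) = pairs b + pairs (flatten R).
  rewrite /= pairs_cat_paired //; last exact: cl_bs.
  by apply: (doubled_cat (A := flatten L ++ A ++ flatten M ++ B) (B := [::])); rewrite cats0 -!catA.
rewrite pR in ltB leLR leRL ltLR' lt_vR unsaved.
have [v' eq_v'] := cut_eq_exists n.+1 (doubled_line pbs').
have le_bc := bs_le b_bs; have le_bB := leq_trans le_bc cB.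
have le_bA := leq_trans le_bc cA.
have def_W (P Q : seq T) : flatten L ++ A ++ flatten M ++ P ++ Q ++ flatten R =
    (flatten L ++ A ++ flatten M) ++ P ++ Q ++ flatten R by rewrite -!catA.
have eq_v'2 : cut_eq n.+2 v' ((flatten L ++ A ++ flatten M) ++ b ++ B ++ flatten R).
  by move: eq_v'; rewrite /line flatten_rcons -!catA.
rewrite def_W in eq_v dW; rewrite addnC in lt_vR.
have [lt1 lt2 lt3] :=
  swap_bounds_right dW clR1 (cl_bs b_bs) clB (bs0 b_bs) le_bB eq_v eq_v'2 lt_vR.
apply: (IHm L (rcons M b) R v') => //; first by move: le_m => /=; lia.
by split; lia.
Qed.

(** The first alternative is a cut without split letters: the bins exhaust
    the word.  Otherwise the value is less than a third of the total, which
    is what the first two conditions of [near_balance] need when the blocks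
    are evenly distributed. *)
Lemma arrange_exists n :
    pairs A < 2 * c -> pairs B < 2 * c -> 3 * c <= pairs (A ++ B ++ flatten bs) ->
  exists L M R v,
    [/\ perm_eq (L ++ M ++ R) bs, cut_eq n.+3 v (line L M R)
      & n.+3 * v = pairs (A ++ B ++ flatten bs) \/
        [/\ near_balance v L R, pairs (flatten L) <= v \/ v < pairs A
          & pairs (flatten R) <= v \/ v < pairs B]].
Proof.
move=> A2c B2c ge3c.
have [||L [R [pLR le1 le2]]] := split_sum (x := pairs A) (y := pairs B) bs_le; try by lia.
have pbs : perm_eq (L ++ [::] ++ R) bs by [].
have [v eq_v] := cut_eq_exists n.+2 (doubled_line pbs).
have d_bs : doubled (flatten bs).
  by apply: (doubled_cat (A := A ++ B) (B := [::])); rewrite cats0 -catA.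
have dLR : doubled (flatten L ++ flatten R).
  by rewrite -flatten_cat; apply: doubled_perm d_bs; rewrite perm_sym perm_flatten.
have sumLR : pairs (A ++ B ++ flatten bs) =
    pairs A + pairs B + \sum_(b <- L) pairs b + \sum_(b <- R) pairs b.
  rewrite !pairs_cat_paired //; last by apply: (doubled_cat (A := A) (B := [::])); rewrite cats0.
  by rewrite (pairs_flatten d_bs) // -(perm_big _ pLR) big_cat !addnA.
have mem_bs b : b \in L ++ R -> b \in bs by rewrite (perm_mem pLR).
have pL : pairs (flatten L) = \sum_(b <- L) pairs b.
  rewrite pairs_flatten // => [|b bL]; first exact: (doubled_cat (A := [::])) dLR.
  by apply/cl_bs/mem_bs; rewrite mem_cat bL.
have pR : pairs (flatten R) = \sum_(b <- R) pairs b.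
  rewrite pairs_flatten // => [|b bR].
    by apply: (doubled_cat (A := flatten L) (B := [::])); rewrite cats0.
  by apply/cl_bs/mem_bs; rewrite mem_cat bR orbT.
rewrite -pL -pR in sumLR le1 le2.
have card_line : pairs (line L [::] R) = pairs (A ++ B ++ flatten bs).
  rewrite /pairs; congr #|pred_of_set _|; apply/setP=> z; rewrite !inE /occ.
  by rewrite (permP (line_perm pbs)).
have := cut_ge_total (doubled_line pbs) (cut_eq_ge eq_v).
rewrite card_line leq_eqVlt => /orP[/eqP total | lt_total].
  by exists L, [::], R, v; split=> //; left.
have lt3 : 3 * v < pairs (A ++ B ++ flatten bs).
  by apply: leq_ltn_trans lt_total; rewrite leq_mul2r orbT.
have [|L' [M' [R' [v' [p1 p2 p3 p4 p5]]]]] := arrange pbs eq_v.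
  by split; lia.
by exists L', M', R', v'; split=> //; right.
Qed.

End Arrange.

End Strings.

(** * Components outside a vertex set, and tours *)

Lemma exists_minimal (A : Type) (P : A -> Prop) (m : A -> nat) :
  (exists a, P a) -> exists2 a, P a & forall b, P b -> m a <= m b.
Proof.
case=> a; have [n] := ubnP (m a); elim: n a => // n IHn a le_man Pa.
case: (classic (exists2 b, P b & m b < m a)) => [[b Pb lt_ba] | no_smaller].
  exact: IHn (leq_trans lt_ba le_man) Pb.
exists a => // b Pb; rewrite leqNgt; apply/negP=> lt_ba.
by apply: no_smaller; exists b.
Qed.

Lemma connect_exit (T : finType) (r : rel T) (A : {pred T}) x y :
  connect r x y -> x \in A -> y \notin A ->
  exists a b, [/\ a \in A, b \notin A & r a b].
Proof.
case/connectP=> p; elim: p x => [|z p IHp] x /= => [_ -> -> // |].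
case/andP=> rxz rp def_y Ax Ay; have [Az | Az] := boolP (z \in A).
  exact: IHp rp def_y Az Ay.
by exists x, z.
Qed.

Section Graph.

Variables (T : finType) (e : rel T).
Hypothesis e_sym : symmetric e.

Definition avoid (S : {set T}) : rel T :=
  [rel a b | [&& a \notin S, b \notin S & e a b]].

(** The component of [x] in the graph without [S]; it is [[set x]] when [x]
    lies in [S]. *)
Definition component (S : {set T}) x := [set y | connect (avoid S) x y].

Implicit Types (S D : {set T}) (P Q W s : seq T) (ss bs : seq (seq T)).

Lemma avoid_sym S : symmetric (avoid S).
Proof. by move=> a b; rewrite /avoid /= e_sym; case: (a \in S); case: (b \in S). Qed.

Lemma comp_refl S x : x \in component S x.
Proof. by rewrite inE connect0. Qed.

Lemma comp_step S x a b : a \in component S x -> avoid S a b -> b \in component S x.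
Proof. by rewrite !inE => xa ab; apply: connect_trans xa (connect1 ab). Qed.

Lemma comp_sym S x y : (y \in component S x) = (x \in component S y).
Proof. by rewrite !inE; apply/sym_connect_sym/avoid_sym. Qed.

Lemma comp_eq S x y : y \in component S x -> component S y = component S x.
Proof.
rewrite inE => xy; apply/setP=> z; rewrite !inE; apply/esym.
exact: (same_connect (sym_connect_sym (@avoid_sym S)) xy).
Qed.

Lemma comp_notin S x y : x \notin S -> y \in component S x -> y \notin S.
Proof.
rewrite inE => xS xy; apply/negP=> yS.
have [||a [b [aS bS]]] := connect_exit (A := [predC S]) xy.
- by rewrite !inE.
- by rewrite !inE negbK.
by rewrite /avoid /= !inE negbK in bS * => /and3P[_]; rewrite bS.
Qed.

Lemma comp_sub S S' x : S \subset S' -> component S' x \subset component S x.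
Proof.
move=> sSS'; apply/subsetP=> y; rewrite !inE; apply: connect_sub => a b.
case/and3P=> aS bS eab; apply: connect1; rewrite /avoid /= eab.
by rewrite (contra (subsetP sSS' a)) ?(contra (subsetP sSS' b)).
Qed.

(** Vertices that are added to [S] away from the component of [x] do not
    touch it. *)
Lemma comp_same S S' x :
    S \subset S' -> x \notin S' ->
    {in S' :\: S, forall v, v \notin component S x} ->
  component S x = component S' x.
Proof.
move=> sSS' xS' far; apply/eqP; rewrite eqEsubset (comp_sub _ sSS') andbT.
apply/subsetP=> y; rewrite inE => xy; apply/negPn/negP=> yC.
have [|a [b [aC bC ab]]] := connect_exit xy _ yC; first exact: comp_refl.
have bx : b \in component S x.
  by apply: comp_step ab; apply: (subsetP (comp_sub x sSS')) aC.
case/and3P: ab => aS bS eab.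
have [bS' | bS'] := boolP (b \in S').
  by have := far b; rewrite inE bS bS' => /(_ isT); rewrite bx.
case/negP: bC; apply: (comp_step aC).
by rewrite /avoid /= (comp_notin xS' aC) bS'.
Qed.

Implicit Types (A B : seq T).

(** A word with these properties serves as the record of a depth-first
    search.  The second clause says that a vertex closed before another one
    is opened is not adjacent to it.  In the third one, the letters of [s]
    that occur in [B] are those that are opened during [s] and still open at
    its end; for an [s] starting at the beginning this is the whole stack. *)
Definition tour W :=
  [/\ doubled W,
      forall A B, W = A ++ B -> {in inner A & inner B, forall z z', ~~ e z z'}
    & forall A s B, W = A ++ s ++ B -> sorted e [seq z <- s | z \in B]].

Definition spans W D := forall z, occ z W = (z \in D).*2.

(** The searches of the single components start in [X]: the bottom of the
    stack belongs to [X] at all times. *)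
Definition starts_in (X : {set T}) W := forall A B z r,
  W = A ++ B -> [seq y <- A | y \in B] = z :: r -> z \in X.

Lemma filter_none (a : pred T) s : {in s, forall z, ~~ a z} -> filter a s = [::].
Proof.
by move=> no; apply/eqP; rewrite -(negbK (_ == _)) -has_filter -all_predC; apply/allP.
Qed.

Lemma stack_cat_right (a u : seq T) B :
  {in a, forall z, z \notin B} -> [seq z <- a ++ u | z \in B] = [seq z <- u | z \in B].
Proof. by move=> aB; rewrite filter_cat filter_none. Qed.

Lemma stack_cat_left A (u b : seq T) :
  {in A, forall z, z \notin b} -> [seq z <- A | z \in u ++ b] = [seq z <- A | z \in u].
Proof. by move=> Ab; apply: eq_in_filter => z /Ab; rewrite mem_cat => /negPf->; rewrite orbF. Qed.

Lemma tour_cat (a b : seq T) :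
    tour a -> tour b -> {in a, forall z, z \notin b} -> {in a & b, forall z z', ~~ e z z'} ->
  tour (a ++ b).
Proof.
move=> [da sep_a path_a] [db sep_b path_b] dis nadj; split=> [z|A B|A s B].
- have := dis z; have := da z; have := db z; rewrite occ_cat !mem_occ; lia.
- case/cat_cases=> [[u [-> def_b]] | [u [def_a ->]]] z z' zA zB.
    have z'b : z' \in b.
      by move: zB; rewrite def_b inE !mem_occ occ_cat; lia.
    have [za | za] := boolP (z \in a); first exact: nadj.
    by apply: (sep_b _ _ def_b) => //; move: zA za; rewrite !inE occ_cat mem_occ; lia.
  have za : z \in a by move: zA; rewrite def_a inE !mem_occ occ_cat; lia.
  have [z'b | z'b] := boolP (z' \in b); first exact: nadj.
  by apply: (sep_a _ _ def_a) => //; move: zB z'b; rewrite !inE occ_cat !mem_occ; lia.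
case/cat_cases=> [[u [def_A def_b]] | [b1 [def_a def_sB]]].
  exact: path_b def_b.
case/cat_cases: def_sB => [[u [def_b1 def_B]] | [u [def_s def_b]]].
  rewrite def_B stack_cat_left; first by apply: path_a; rewrite def_a def_b1.
  by move=> z zs; apply: dis; rewrite def_a def_b1 !mem_cat zs orbT.
rewrite def_s stack_cat_right; first by apply: (path_b [::]); rewrite def_b.
move=> z zb1; have zb : z \notin b by apply: dis; rewrite def_a mem_cat zb1 orbT.
by apply: contra zb; rewrite def_b mem_cat => ->; rewrite orbT.
Qed.

Lemma started_cat (X : {set T}) (a b : seq T) :
    {in a, forall z, z \notin b} -> starts_in X a -> starts_in X b -> starts_in X (a ++ b).
Proof.
move=> dis sta stb A B z r /cat_cases[[u [-> def_b]] | [u [def_a ->]]].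
  rewrite stack_cat_right; first exact: stb def_b.
  by move=> y /dis; apply: contra => yB; rewrite def_b mem_cat yB orbT.
rewrite stack_cat_left; first exact: sta def_a.
by move=> y yA; apply: dis; rewrite def_a mem_cat yA.
Qed.

Lemma wrap_split (v : T) W A B : v :: rcons W v = A ++ B ->
  [\/ A = [::], B = [::] | exists A1 B1, [/\ A = v :: A1, B = rcons B1 v & W = A1 ++ B1]].
Proof.
case: A => [|x A]; first by constructor 1.
case/lastP: B => [|B y]; first by constructor 2.
rewrite /= -rcons_cat => -[<-] /rcons_inj[-> <-].
by constructor 3; exists A, B.
Qed.

(** The search enters [v], performs the searches recorded in [W] from
    neighbours of [v], and leaves [v].  Meanwhile [v] is the bottom of the
    stack, followed by a neighbour. *)
Lemma tour_wrap v W :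
    tour W -> v \notin W -> starts_in [set z | e v z] W -> tour (v :: rcons W v).
Proof.
move=> [dW sep_W path_W] vW stW.
have occ_out (s : seq T) z : z \notin s -> occ z s = 0 by rewrite mem_occ; case: occ.
have occ_v (s t : seq T) : W = s ++ t -> occ v s = 0 /\ occ v t = 0.
  move=> def_W; have /eqP := occ_out _ _ vW.
  by rewrite def_W occ_cat addn_eq0 => /andP[/eqP-> /eqP->].
split=> [z|A B|A s B].
- rewrite occ_cons occ_rcons; case: eqVneq => [<-|_]; last by have := dW z; lia.
  by rewrite occ_out.
- case/wrap_split=> [->|->|[A1 [B1 [-> -> def_W]]]] z z'; rewrite !inE ?occ_cons //.
  rewrite occ_rcons; have [ov1 ov2] := occ_v _ _ def_W.
  have [<- | _] := eqVneq v z; first by rewrite ov1.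
  have [<- | _] := eqVneq v z'; first by rewrite ov2.
  by move=> zA zB; apply: (sep_W _ _ def_W); rewrite inE.
rewrite catA => /wrap_split[|->|[A1 [B1 [def_As -> def_W]]]].
- by case: A => //; case: s.
- by rewrite filter_none.
have [ov1 ov2] := occ_v _ _ def_W.
have stack_v t : v \notin t -> [seq z <- t | z \in rcons B1 v] = [seq z <- t | z \in B1].
  move=> vt; apply: eq_in_filter => z zt; rewrite mem_rcons inE; case: eqVneq => // zv.
  by rewrite -zv zt in vt.
case: A def_As => [|x A] /=; last first.
  case=> _ def_A1; rewrite stack_v.
    by apply: (path_W A); rewrite def_W -def_A1 catA.
  by rewrite mem_occ -leqNgt leqn0; move: ov1; rewrite -def_A1 occ_cat; lia.
move=> ->; rewrite /= mem_rcons mem_head stack_v; last by rewrite mem_occ ov1.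
have := path_W [::] A1 B1 def_W; have := stW A1 B1 _ _ def_W.
case: [seq z <- A1 | z \in B1] => //= z r st ->; rewrite andbT.
by have := st z r erefl; rewrite inE.
Qed.

Lemma started_wrap (X : {set T}) v W :
  v \notin W -> v \in X -> starts_in X (v :: rcons W v).
Proof.
move=> vW vX A B z r /wrap_split[->|->|[A1 [B1 [-> -> _]]]] //.
  by rewrite filter_none.
by rewrite /= mem_rcons mem_head => -[<- _].
Qed.

Lemma spans_mem W D z : spans W D -> (z \in W) = (z \in D).
Proof. by move=> sp; rewrite mem_occ sp; case: (z \in D). Qed.

Lemma spans_paired W D : spans W D -> paired W.
Proof. by move=> sp z; rewrite (spans_mem _ sp) sp => ->. Qed.

Lemma spans_inner W D : spans W D -> inner W = D.
Proof. by move=> sp; apply/setP=> z; rewrite inE sp; case: (z \in D). Qed.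

(** [D] is a union of components of the complement of [S]. *)
Definition stable S D := {in D, forall a, a \notin S} /\
  forall a b, a \in D -> avoid S a b -> b \in D.

Lemma comp_in S D a b : stable S D -> a \in D -> b \in component S a -> b \in D.
Proof.
move=> [_ stD] aD; rewrite inE => ab; apply/negPn/negP=> bD.
have [p [q [pD /negP qD pq]]] := connect_exit ab aD bD.
by apply: qD; apply: stD pq.
Qed.

Lemma comp_stable S a : a \notin S -> stable S (component S a).
Proof.
move=> aS; split=> [b|b d]; first exact: comp_notin.
exact: comp_step.
Qed.

Lemma stable_setD S D v : stable S D -> stable S (D :\: component S v).
Proof.
move=> [DS stD]; split=> [a|a b]; rewrite !inE => /andP[av aD]; first exact: DS.
move=> ab; rewrite (stD _ _ aD ab) andbT; apply: contra av => bv.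
by apply: connect_trans bv (connect1 _); rewrite avoid_sym.
Qed.

(** Enter some [v] in [X]; what remains of its component falls into components
    outside [v |: S], each of which contains a neighbour of [v], so that it
    can be searched from there before [v] is left.  Then search the other
    components. *)
Lemma tour_exists S D (X : {set T}) :
    stable S D -> {in D, forall a, exists2 w, w \in X & w \in component S a} ->
  exists W, [/\ tour W, spans W D & starts_in X W].
Proof.
have [n] := ubnP #|D|; elim: n S D X => // n IHn S D X; rewrite ltnS => le_n stD startD.
have [D0 | [u uD]] := set_0Vmem D.
  exists [::]; split=> [|z|A B z r]; first split=> [//|A B|A s B].
  - by case: A => //; case: B => // _ z z'; rewrite inE.
  - by case: A => //; case: s.
  - by rewrite D0 inE.
  by case: A.
have [v vX vu] := startD u uD; have vD := comp_in stD uD vu; have vS := stD.1 v vD.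
pose D1 := component S v :\ v; pose D2 := D :\: component S v; pose S1 := v |: S.
have sCD : component S v \subset D by apply/subsetP=> a; apply: comp_in.
have D1_lt : #|D1| < n.
  apply: leq_trans le_n; apply: proper_card; apply/properP; split.
    exact: subset_trans (subD1set _ _) sCD.
  by exists v; rewrite ?inE ?eqxx.
have D2_lt : #|D2| < n.
  apply: leq_trans le_n; apply: proper_card; apply/properP; split; first exact: subsetDl.
  by exists v; rewrite ?inE ?connect0.
have stD1 : stable S1 D1.
  split=> [a|a b]; rewrite !inE => /andP[av va].
    by rewrite (negPf av) /=; apply: (comp_notin vS); rewrite inE.
  case/and3P; rewrite !inE !negb_or => /andP[_ aS] /andP[-> bS] eab /=.
  by apply: connect_trans va (connect1 _); apply/and3P.
have startD1 : {in D1, forall a, exists2 w, w \in [set z | e v z] & w \in component S1 a}.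
  move=> a aD1; have aS1 := stD1.1 a aD1; move: aD1; rewrite inE => /andP[_ aC].
  have av : connect (avoid S) a v by move: aC; rewrite comp_sym inE.
  have vC : v \notin component S1 a.
    by apply/negP=> /(comp_notin aS1); rewrite !inE eqxx.
  have [p [q [pC qC /and3P[pS qS epq]]]] := connect_exit av (comp_refl S1 a) vC.
  exists p => //; rewrite inE e_sym.
  have [<- // | qv] := eqVneq q v; case/negP: qC; apply: (comp_step pC).
  by rewrite /avoid /= epq (comp_notin aS1 pC) !inE negb_or qv qS.
have [W1 [tW1 spW1 stW1]] := IHn S1 D1 _ D1_lt stD1 startD1.
have stD2 : stable S D2 by apply: stable_setD.
have startD2 : {in D2, forall a, exists2 w, w \in X & w \in component S a}.
  by move=> a; rewrite inE => /andP[_]; apply: startD.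
have [W2 [tW2 spW2 stW2]] := IHn S D2 X D2_lt stD2 startD2.
have vW1 : v \notin W1 by rewrite (spans_mem _ spW1) !inE eqxx.
have mem_wrap z : (z \in v :: rcons W1 v) = (z \in component S v).
  rewrite inE mem_rcons inE orbA orbb (spans_mem _ spW1) inE in_set1.
  by case: eqVneq => // ->; rewrite comp_refl.
have dis : {in v :: rcons W1 v, forall z, z \notin W2}.
  by move=> z; rewrite mem_wrap (spans_mem _ spW2) in_setD => ->.
exists ((v :: rcons W1 v) ++ W2); split.
- apply: tour_cat => //; first exact: tour_wrap.
  move=> z z'; rewrite mem_wrap (spans_mem _ spW2) in_setD => zC /andP[z'C z'D].
  apply: contra z'C => ezz'; apply: (comp_step zC).
  by rewrite /avoid /= ezz' (comp_notin vS zC) (stD.1 _ z'D).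
- move=> z; rewrite occ_cat occ_cons occ_rcons spW1 spW2 !inE.
  rewrite [v == z]eq_sym; have [-> | zv] /= := eqVneq z v; first by rewrite connect0 vD.
  have := subsetP sCD z; rewrite inE.
  by case: (connect (avoid S) v z) => [-> //|_] /=; rewrite addn0.
by apply: started_cat => //; apply: started_wrap.
Qed.

(** One tour for each component of the complement of [S] in [D]. *)
Lemma blocks_exist S D c :
    stable S D -> {in D, forall a, #|component S a| <= c} ->
  exists bs, [/\ spans (flatten bs) D, {in bs, forall b, tour b /\ paired b},
      {in bs, forall b, b != [::] /\ pairs b <= c}
    & {in bs, forall b : seq T, forall a d, a \in b -> avoid S a d -> d \in b}].
Proof.
have [n] := ubnP #|D|; elim: n D => // n IHn D; rewrite ltnS => le_n stD le_c.
have [D0 | [u uD]] := set_0Vmem D.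
  by exists [::]; split=> // z; rewrite D0 inE.
have uS := stD.1 u uD.
have sCD : component S u \subset D by apply/subsetP=> a; apply: comp_in.
have [b [tb spb _]] : exists b, [/\ tour b, spans b (component S u) & starts_in setT b].
  apply: tour_exists (comp_stable uS) _ => a aC.
  by exists a; [rewrite inE | apply: comp_refl].
have [||bs [sp_bs t_bs c_bs st_bs]] := IHn _ _ (stable_setD u stD).
- apply: leq_trans le_n; apply: proper_card; apply/properP; split; first exact: subsetDl.
  by exists u; rewrite ?inE ?connect0.
- by move=> a; rewrite inE => /andP[_]; apply: le_c.
exists (b :: bs); split=> [z|d|d|d].
- rewrite /= occ_cat spb sp_bs in_setD.
  by have := subsetP sCD z; case: (z \in component S u) => [->|].
- by rewrite inE => /predU1P[-> | /t_bs//]; split=> //; apply: spans_paired spb.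
- rewrite inE => /predU1P[-> | /c_bs//]; split; last first.
    by rewrite /pairs (spans_inner spb) le_c.
  by apply/eqP=> b0; have := spans_mem u spb; rewrite b0 comp_refl.
rewrite inE => /predU1P[-> | /st_bs//] a y; rewrite !(spans_mem _ spb).
exact: comp_step.
Qed.

Lemma tour_flatten bs :
    doubled (flatten bs) -> {in bs, forall b, tour b /\ paired b} ->
    {in bs, forall b : seq T, forall z z', z \in b -> z' \in flatten bs -> e z z' -> z' \in b} ->
  tour (flatten bs).
Proof.
elim: bs => [|b bs IH] /= dW tb nadj.
  by split=> [//|A B|A s B]; case: A => //; [case: B => // _ z z'; rewrite inE | case: s].
have [tour_b pb] := tb b (mem_head _ _).
have dis := paired_disjoint dW pb.
apply: tour_cat => //; first apply: IH.
- by apply: (doubled_cat (A := b) (B := [::])); rewrite cats0.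
- by move=> d d_bs; apply: tb; rewrite inE d_bs orbT.
- move=> d d_bs z z' zd z'_bs; apply: nadj => //; first by rewrite inE d_bs orbT.
  by rewrite mem_cat z'_bs orbT.
move=> z z' zb z'_bs; apply/negP=> ezz'.
suff /dis : z' \in b by rewrite z'_bs.
by apply: nadj ezz' => //; rewrite ?mem_head // mem_cat z'_bs orbT.
Qed.

(** [links ss B] lists, for each piece, the vertices opened but not closed in
    it, where [B] is the text that follows the pieces.  A vertex closed in a
    piece and opened earlier belongs to the link of the earlier piece. *)
Fixpoint links ss B : seq (seq T) :=
  if ss is s :: ss' then [seq z <- s | z \in flatten ss' ++ B] :: links ss' B else [::].

Lemma size_links ss B : size (links ss B) = size ss.
Proof. by elim: ss => //= s ss ->. Qed.

Lemma links_cat ss tt B : links (ss ++ tt) B = links ss (flatten tt ++ B) ++ links tt B.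
Proof. by elim: ss => //= s ss ->; rewrite flatten_cat catA. Qed.

Lemma links_sorted ss A B : tour (A ++ flatten ss ++ B) -> all (sorted e) (links ss B).
Proof.
elim: ss A => //= s ss IH A tW; apply/andP; split.
  by case: tW => _ _ path_W; apply: (path_W A); rewrite -!catA.
by apply: (IH (A ++ s)); rewrite -!catA in tW *.
Qed.

Lemma links_uniq ss B : doubled (flatten ss ++ B) -> uniq (flatten (links ss B)).
Proof.
elim: ss => //= s ss IH dW; rewrite cat_uniq.
have dW' : doubled (s ++ flatten ss ++ B) by rewrite catA.
have in_links z : z \in flatten (links ss B) -> 1 < occ z (flatten ss ++ B).
  elim: {IH dW dW'}ss => //= t ss IH; rewrite mem_cat mem_filter => /orP[/andP[]|/IH z2].
    by rewrite -catA occ_cat !mem_occ; lia.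
  by rewrite -catA occ_cat (leq_trans z2) ?leq_addl.
apply/and3P; split.
- apply: count_mem_uniq => z; rewrite mem_filter -[count_mem z _]/(occ z _).
  have [zl | zl] := boolP (z \in flatten ss ++ B); last first.
    by apply/count_memPn; rewrite mem_filter negb_and zl.
  have := dW' z; rewrite occ_cat /occ count_filter -/(occ z s) => le2.
  rewrite (eq_count (a2 := pred1 z)) => [|y /=]; last by case: eqVneq => [->|].
  by rewrite -/(occ z s) mem_occ; move: zl; rewrite mem_occ -/(occ z (flatten ss ++ B)) in le2 *; lia.
- apply/hasPn=> z /in_links z2; rewrite mem_filter negb_and; apply/orP; right.
  by rewrite mem_occ; have := dW' z; rewrite occ_cat; lia.
by apply: IH; apply: (doubled_cat (A := s) (B := [::])); rewrite cats0.
Qed.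

Lemma has_inner ss z : has (fun s => z \in inner s) ss -> 1 < occ z (flatten ss).
Proof.
by elim: ss => //= s ss IH; rewrite occ_cat inE => /orP[|/IH]; lia.
Qed.

Lemma mem_links ss z : doubled (flatten ss) -> paired (flatten ss) ->
  (z \in flatten (links ss [::])) = (z \in flatten ss) && ~~ has (fun s => z \in inner s) ss.
Proof.
move=> dW pW; have := pW z; have := dW z; rewrite mem_occ.
suff memE : occ z (flatten ss) <= 2 -> (z \in flatten (links ss [::])) =
    (occ z (flatten ss) == 2) && ~~ has (fun s => z \in inner s) ss.
  by move=> le2 gt1; rewrite memE //; congr (_ && _); lia.
elim: ss {dW pW} => //= s ss IH.
rewrite occ_cat mem_cat mem_filter cats0 negb_or inE -leqNgt !mem_occ => le2.
have := IH; have := @has_inner ss z; rewrite mem_occ.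
by case: (has _ _) => /= [/(_ isT) gt1|_] ->; lia.
Qed.

(** * A vertex set that no path can usefully extend *)

Definition traces P S := [/\ sorted e P, uniq P & P =i S].

Definition traceable S := exists P, traces P S.

(** The consequences of the choice of [S] that the construction uses; [c] is
    the size of the largest component of the complement. *)
Record critical c S : Prop := Critical {
  critical_traceable : traceable S;
  critical_le : forall x, x \notin S -> #|component S x| <= c;
  critical_extend : forall S' b, traceable S' -> S \subset S' ->
    b \in S' -> b \notin S -> #|component S b| < c;
  critical_shrink : forall v, v \in S -> traceable (S :\ v) ->
    c <= #|component (S :\ v) v|;
  critical_attained : (exists x, x \notin S) -> exists2 b, b \notin S & #|component S b| = c
}.

(** First minimise the largest component size, with minimum [c]; then, among
    the sets that attain it, minimise lexicographically the number of vertices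
    in components of size [c] and the size of the set.  Taking in a vertex of a
    component of size [c] would decrease the former.  Giving up an end of the
    path decreases the latter, so it must increase the former, which happens
    only if the component created has size at least [c]. *)
Lemma exists_critical : exists c S, critical c S.
Proof.
pose maxc S := \max_(x in ~: S) #|component S x|.
have maxcP S c : reflect (forall x, x \notin S -> #|component S x| <= c) (maxc S <= c).
  by apply: (iffP (bigmax_leqP _ _ _)) => le_c x; have:= le_c x; rewrite inE.
have [|S0 covS0 minS0] := @exists_minimal _ traceable maxc.
  by exists set0, [::]; split=> // x; rewrite !inE.
pose c := maxc S0; pose big S := [set x in ~: S | c <= #|component S x|].
(* Since #|S| <= #|T|, this weight orders the sets lexicographically. *)
pose m S := #|big S| * #|T|.+1 + #|S|.
have [|S [covS leS] minS] :=
  @exists_minimal _ (fun S => traceable S /\ maxc S <= c) m; first by exists S0.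
move/maxcP: (leS) => leS'.
exists c, S; split=> // [S' b covS' sSS' bS' bS | v vS covSv | [x xS]].
- rewrite ltnNge; apply/negP=> big_b.
  have leS'c: maxc S' <= c.
    apply/maxcP=> x xS'; apply: leq_trans (leS' x _).
      exact/subset_leq_card/comp_sub.
    by apply: contra xS'; apply: (subsetP sSS').
  have : #|big S'| < #|big S|.
    apply: proper_card; apply/properP; split.
      apply/subsetP=> x; rewrite !inE => /andP[xS' big_x]; apply/andP; split.
        by apply: contra xS'; apply: (subsetP sSS').
      exact: leq_trans big_x (subset_leq_card (comp_sub _ sSS')).
    by exists b; rewrite !inE ?bS ?bS'.
  have := minS S' (conj covS' leS'c); rewrite /m.
  have := max_card S'; nia.
- rewrite leqNgt; apply/negP=> small_v.
  have sSv : S :\ v \subset S by apply: subD1set.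
  have vSv : v \notin S :\ v by rewrite !inE eqxx.
  have comp_case x : x \notin S :\ v -> 
      #|component (S :\ v) x| < c \/ x \notin S /\ component (S :\ v) x = component S x.
    move=> xSv; have [vx | vx] := boolP (v \in component (S :\ v) x).
      by left; rewrite -(comp_eq vx).
    have xS : x \notin S.
      move: xSv; rewrite !inE negb_and negbK => /orP[/eqP xv | //].
      by rewrite xv comp_refl in vx.
    right; split=> //; apply: comp_same => // w.
    rewrite !inE negb_and negbK andb_orl andNb orbF => /andP[/eqP-> _].
    by rewrite inE in vx.
  have leSv : maxc (S :\ v) <= c.
    apply/maxcP=> x /comp_case[/ltnW // | [xS ->]]; exact: leS'.
  have : #|big (S :\ v)| <= #|big S|.
    apply/subset_leq_card/subsetP=> x.
    rewrite inE in_setC => /andP[/comp_case[|[xS ->]]]; first by case: ltngtP.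
    by rewrite !inE xS.
  have := minS _ (conj covSv leSv); rewrite /m (cardsD1 v S) vS; nia.
have c_gt0 : 0 < c.
  by apply: leq_trans (leS' x xS); apply/card_gt0P; exists x; apply: comp_refl.
have [/set0Pn[b] | /negbNE/eqP big0] := boolP (big S != set0).
  rewrite !inE => /andP[bS cb]; exists b => //.
  by apply/eqP; rewrite eqn_leq cb leS'.
suff : maxc S <= c.-1 by move/leq_trans: (minS0 S covS) => /[apply]; rewrite -/c; lia.
apply/maxcP=> y yS; suff : #|component S y| < c by lia.
have := in_set0 y; rewrite -big0 !inE yS /= => /negbT; by rewrite -ltnNge.
Qed.

Lemma sorted_rev P : sorted e (rev P) = sorted e P.
Proof. by rewrite rev_sorted; apply: eq_sorted => a b; rewrite e_sym. Qed.

Section CriticalPath.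

Variables (c : nat) (S : {set T}).
Hypothesis crit : critical c S.

Lemma no_extension P b :
    sorted e P -> uniq P -> {subset S <= P} -> b \in P -> b \notin S -> #|component S b| = c ->
  False.
Proof.
move=> sP uP SP bP bS cb.
have traceP : traceable [set z in P] by exists P; split=> // z; rewrite inE.
have sSP : S \subset [set z in P] by apply/subsetP=> z /SP; rewrite inE.
have bP' : b \in [set z in P] by rewrite inE.
by have := critical_extend crit traceP sSP bP' bS; rewrite cb ltnn.
Qed.

Lemma end_far x P b :
  traces (x :: P) S -> b \notin S -> #|component S b| = c -> ~~ e b x.
Proof.
move=> [sP uP memP] bS cb; apply/negP=> ebx.
apply: (@no_extension (b :: x :: P) b); rewrite ?mem_head //.
- by rewrite /= ebx.
- by rewrite cons_uniq uP memP bS.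
by move=> z zS; rewrite inE memP zS orbT.
Qed.

(** A walk from [x] to [y] outside [S] closes the path to a cycle through all
    of [S].  If the cycle contains [b], it is a path reaching a component of
    size [c]; if not, opening the cycle at [a] and putting [b] in front gives
    such a path. *)
Lemma ends_separated x M y b a :
    traces (x :: rcons M y) S -> b \notin S -> #|component S b| = c -> a \in S -> e b a ->
  y \notin component (S :\: [set x; y]) x.
Proof.
move=> [sP uP memP] bS cb aS eba; apply/negP; rewrite inE => /connectP[p0 path_p0 def_y].
move: def_y; case/shortenP: path_p0 => p path_p uniq_p _ def_y.
have yx : y != x.
  by move: uP; rewrite /= mem_rcons inE eq_sym; case: eqVneq.
case/lastP: p def_y path_p uniq_p => [|mid y'] /=; first by move=> yx'; rewrite yx' eqxx in yx.
rewrite last_rcons => <-{y'} path_p; rewrite mem_rcons inE negb_or rcons_uniq.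
case/and3P=> /andP[_ x_mid] y_mid uniq_mid.
have mid_out z : z \in mid -> z \notin S.
  move=> zm; have : z \notin S :\: [set x; y].
    have : z \in rcons mid y by rewrite mem_rcons inE zm orbT.
    by move=> zp; case/splitPr: zp path_p => p1 p2; rewrite cat_path /= => /and3P[_ /and3P[]].
  rewrite !inE negb_and negbK => /orP[/orP[/eqP zx | /eqP zy] | //].
    by rewrite -zx zm in x_mid.
  by rewrite -zy zm in y_mid.
have path_mid : path e x (rcons mid y) by apply: sub_path path_p => u w /and3P[].
pose cyc := x :: rcons M y ++ rev mid.
have cycle_cyc : cycle e cyc.
  rewrite /cyc /= rcons_cat cat_path (sP : path e x (rcons M y)) last_rcons /=.
  have -> : path e y (rcons (rev mid) x) = sorted e (rev (x :: rcons mid y)).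
    by rewrite rev_cons rev_rcons.
  by rewrite sorted_rev.
have uniq_cyc : uniq cyc.
  rewrite /cyc -cat_cons cat_uniq uP rev_uniq uniq_mid andbT.
  by apply/hasPn=> z; rewrite mem_rev memP; apply: mid_out.
have S_cyc : {subset S <= cyc} by move=> z zS; rewrite /cyc -cat_cons mem_cat memP zS.
have [b_cyc | b_cyc] := boolP (b \in cyc).
  apply: (@no_extension cyc b) => //; move: cycle_cyc.
  by rewrite /cyc /= rcons_path => /andP[].
(* The cycle is opened at the neighbour of [b]. *)
have [i cyc' def_cyc] := rot_to (S_cyc a aS).
have perm_cyc : perm_eq (a :: cyc') cyc by rewrite -def_cyc perm_rot.
apply: (@no_extension (b :: a :: cyc') b); rewrite ?mem_head //=.
- rewrite eba /=; have := cycle_cyc; rewrite -(rot_cycle i) def_cyc /=.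
  by rewrite rcons_path => /andP[].
- by have := perm_uniq perm_cyc; rewrite uniq_cyc /= => ->; rewrite (perm_mem perm_cyc) b_cyc.
by move=> z /S_cyc zc; rewrite inE (perm_mem perm_cyc) zc orbT.
Qed.

End CriticalPath.

(** Components of size at most [c] are dropped one at a time until fewer than
    [2 * c] vertices are left. *)
Lemma stable_part S D c :
    stable S D -> {in D, forall a, #|component S a| <= c} -> c <= #|D| -> 0 < c ->
  exists A : {set T}, [/\ A \subset D, stable S A & c <= #|A| < 2 * c].
Proof.
move=> + + + c_gt0; have [n] := ubnP #|D|; elim: n D => // n IHn D; rewrite ltnS => le_n stD le_c cD.
have [lt_2c | ge_2c] := ltnP #|D| (2 * c); first by exists D; rewrite subxx cD.
have [u uD] : exists u, u \in D by apply/card_gt0P; lia.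
have sCD : component S u \subset D by apply/subsetP=> a; apply: comp_in.
have cardD : #|D :\: component S u| = #|D| - #|component S u| by rewrite cardsD (setIidPr sCD).
have cu := le_c u uD; have cu_gt0 : 0 < #|component S u|.
  by apply/card_gt0P; exists u; apply: comp_refl.
have [||||A [sAD stA cA]] := IHn (D :\: component S u).
- by rewrite cardD; lia.
- exact: stable_setD.
- by move=> a; rewrite inE => /andP[_]; apply: le_c.
- by rewrite cardD; lia.
by exists A; split=> //; apply: subset_trans sAD (subsetDl _ _).
Qed.

(** * The core path and the regions at its ends *)

Definition nbhd v := [set z | e v z].

(** Near an end [v] of the path, the set [A] is found in the component that
    [v] would belong to if both ends were released.  If this component has
    exactly [c] vertices, it is [A]: the end is popped from the path and
    becomes the vertex at which the search of [A] starts.  If it is larger,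
    the end stays, and [A] is chosen among the components that touch it;
    their searches start at neighbours of [v]. *)
Lemma end_region S v w c :
    v \in S -> v != w -> w \notin component (S :\: [set v; w]) v ->
    {in ~: S, forall a, #|component S a| <= c} -> 0 < c ->
    c <= #|component (S :\: [set v; w]) v| ->
  exists (pop : bool) (A X : {set T}),
    [/\ A \subset component (S :\: [set v; w]) v, c <= #|A| < 2 * c
      & if pop then A = component (S :\: [set v; w]) v /\ X = [set v]
        else [/\ stable S A, X = nbhd v
               & {in A, forall a, exists2 z, z \in X & z \in component S a}]].
Proof.
move=> vS vw sep le_c c_gt0 cC; set R := S :\: [set v; w] in sep cC *.
have vR : v \notin R by rewrite !inE eqxx.
have sRS : R \subset S by apply: subsetDl.
have [Cc | Cc] := eqVneq #|component R v| c.
  by exists true, (component R v), [set v]; rewrite subxx Cc leqnn; split=> //; lia.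
pose D := component R v :\ v.
have DS a : a \in D -> a \notin S.
  rewrite in_setD1 => /andP[av aC]; have := comp_notin vR aC; rewrite !inE (negPf av) /=.
  by case: eqVneq => [aw|_] //; rewrite aw (negPf sep) in aC.
have stD : stable S D.
  split=> // a b aD /and3P[aS bS eab]; move: aD; rewrite !in_setD1 => /andP[av aC].
  have bv : b != v by apply: contraNneq bS => ->.
  rewrite bv; apply: comp_step aC _.
  by rewrite /avoid /= eab !(contra (subsetP sRS _)).
have cardD : c <= #|D| by have := cardsD1 v (component R v); rewrite comp_refl -/D; lia.
have [|A [sAD stA cA]] := stable_part stD _ cardD c_gt0.
  by move=> a /DS aS; apply: le_c; rewrite inE.
exists false, A, (nbhd v); split=> //; first exact: subset_trans sAD (subD1set _ _).
split=> // a /(subsetP sAD) aD; have aS := DS a aD.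
move: aD; rewrite in_setD1 => /andP[_ aC].
have av : connect (avoid R) a v by move: aC; rewrite comp_sym inE.
have vC : v \notin component S a by apply/negP=> /(comp_notin aS); rewrite vS.
have [p [q [pC qC pq]]] := connect_exit av (comp_refl S a) vC.
have pS := comp_notin aS pC; case/and3P: (pq) => pR qR epq.
have qS : q \in S.
  by apply: contraR qC => qS; apply: comp_step pC _; rewrite /avoid /= pS qS.
exists p => //; rewrite inE e_sym.
move: qR; rewrite !inE qS andbT negbK => /orP[/eqP<- // | /eqP qw].
case/negP: sep; rewrite -qw; apply: comp_step pq; rewrite -(comp_eq aC).
exact: subsetP (comp_sub a sRS) p pC.
Qed.

(** The set found near [v] is a union of components also of the complement of
    the core path, where the decision about the other end [w] has no
    influence, because [w] does not touch the component of [v]. *)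
Lemma region_stable S (K : {set T}) v w (pop : bool) (A X : {set T}) (R := S :\: [set v; w]) :
    v \in S -> w \notin component R v -> R \subset K -> K \subset S -> (v \in K) = ~~ pop ->
    A \subset component R v ->
    (if pop then A = component R v /\ X = [set v]
     else [/\ stable S A, X = nbhd v
            & {in A, forall a, exists2 z, z \in X & z \in component S a}]) ->
  stable K A /\ {in A, forall a, exists2 z, z \in X & z \in component K a}.
Proof.
move=> vS sep sRK sKS vK sAC; have vR : v \notin R by rewrite !inE eqxx.
have notinR u : u \in S -> u \notin R -> u = v \/ u = w.
  by move=> uS; rewrite !inE uS andbT negbK => /orP[/eqP | /eqP]; [left | right].
case: pop vK => /= vK => [[defA defX] | [[AS stA] defX startA]].
  have stA : stable K A.
    rewrite defA; split=> [a aC | a b aC /and3P[aK bK eab]].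
      apply/negP=> aK; have [av | aw] := notinR a (subsetP sKS a aK) (comp_notin vR aC).
        by rewrite av vK in aK.
      by rewrite aw (negPf sep) in aC.
    by apply: comp_step aC _; rewrite /avoid /= eab !(contra (subsetP sRK _)).
  split=> // a aA; exists v; first by rewrite defX inE.
  have aC : a \in component R v by rewrite -defA.
  rewrite -(comp_same sRK) ?(comp_eq aC) ?comp_refl //; first exact: stA.1.
  move=> u; rewrite inE => /andP[uR uK].
  by have [uv | -> //] := notinR u (subsetP sKS u uK) uR; rewrite uv vK in uK.
split.
  split=> [a /AS | a b aA /and3P[aK bK eab]]; first exact/contra/(subsetP sKS).
  have aS := AS a aA.
  have bC : b \in component R v.
    apply: comp_step (subsetP sAC a aA) _.
    by rewrite /avoid /= eab !(contra (subsetP sRK _)).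
  apply: stA aA _; rewrite /avoid /= aS eab andbT; apply/negP=> bS.
  have [bv | bw] := notinR b bS (comp_notin vR bC); first by rewrite bv vK in bK.
  by rewrite bw (negPf sep) in bC.
by move=> a /startA[z zX za]; exists z => //; apply: subsetP (comp_sub a sKS) z za.
Qed.

Lemma join_left (pop : bool) (X : {set T}) x K' P :
    X = (if pop then [set x] else nbhd x) -> sorted e (x :: K') -> sorted e P ->
    (forall z r, P = z :: r -> z \in X) ->
  sorted e (rev P ++ (if pop then [::] else [:: x]) ++ K').
Proof.
move=> -> sK sP hP; case: P sP hP => [|z r] sP hP.
  by case: (pop) => //=; apply: path_sorted sK.
have := hP z r erefl; case: (pop) => /=.
  rewrite inE => /eqP zx; rewrite zx in sP *.
  by rewrite rev_cons cat_rcons sorted_cat_cons -rev_cons sorted_rev sP.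
rewrite inE => exz; rewrite sorted_cat_cons -rev_cons sorted_rev.
by rewrite (sK : path e x K') andbT /= exz.
Qed.

(** The first alternative arises when the critical set is everything.  The 3c vertices outside [K]
    are those of [A], of [B] and of a component of size [c] touching neither
    end of the path. *)
Lemma core_path :
    (forall x y, connect e x y) ->
  (exists P, traces P setT) \/
  exists c K (A B X Y : {set T}),
   [/\ [/\ uniq K, stable [set z in K] A, stable [set z in K] B & [disjoint A & B]],
       [/\ c <= #|A| < 2 * c, c <= #|B| < 2 * c, 3 * c <= #|~: [set z in K]|
         & {in ~: ([set z in K] :|: A :|: B), forall a, #|component [set z in K] a| <= c}],
       {in A, forall a, exists2 w, w \in X & w \in component [set z in K] a},
       {in B, forall a, exists2 w, w \in Y & w \in component [set z in K] a}
     & forall P Q, sorted e P -> sorted e Q ->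
        (forall z r, P = z :: r -> z \in X) -> (forall z r, Q = z :: r -> z \in Y) ->
        sorted e (rev P ++ K ++ Q)].
Proof.
move=> conn; have [c [S crit]] := exists_critical.
have [S_all | [b0 b0S]] := set_0Vmem (~: S).
  left; have [P [sP uP memP]] := critical_traceable crit; exists P; split=> // z.
  by rewrite memP inE; have := in_set0 z; rewrite -S_all inE => /negbFE.
right; have [|{}b0 {}b0S cb0] := critical_attained crit.
  by exists b0; rewrite inE in b0S.
have c_gt0 : 0 < c by rewrite -cb0; apply/card_gt0P; exists b0; apply: comp_refl.
have [P [sP uP memP]] := critical_traceable crit.
have [u uS] : exists u, u \in S.
  case: P sP uP memP => [|u P] sP uP memP; last by exists u; rewrite -memP mem_head.
  case: (@no_extension _ _ crit [:: b0] b0 isT isT _ (mem_head _ _) b0S cb0) => z.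
  by rewrite -memP.
have uC : u \notin component S b0 by apply: contraL uS; apply: comp_notin.
(* By connectedness, some vertex [b] of a largest component has a neighbour
   [a] on the path. *)
have [b [a [bC aC eba]]] := connect_exit (conn b0 u) (comp_refl S b0) uC.
have bS := comp_notin b0S bC; have cb : #|component S b| = c by rewrite (comp_eq bC).
have aS : a \in S.
  by apply: contraR aC => aS; apply: comp_step bC _; rewrite /avoid /= bS aS.
have [x [M [y def_P]]] : exists x M y, P = x :: rcons M y.
  case: P sP uP memP => [|x [|z P]] sP uP memP.
  - by rewrite -memP in aS.
  - have := end_far crit (And3 sP uP memP) bS cb.
    by move: aS; rewrite -memP inE => /eqP <-; rewrite eba.
  by exists x, (belast z P), (last z P); rewrite -lastI.
rewrite {}def_P in sP uP memP.
have trP : traces (x :: rcons M y) S by [].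
have trP' : traces (y :: rcons (rev M) x) S.
  have -> : y :: rcons (rev M) x = rev (x :: rcons M y) by rewrite rev_cons rev_rcons.
  by split=> [||z]; rewrite ?sorted_rev ?rev_uniq // mem_rev memP.
have [xS yS] : x \in S /\ y \in S by split; rewrite -memP inE ?eqxx // mem_rcons inE eqxx orbT.
have xy : x != y by move: uP; rewrite /= mem_rcons inE; case: eqVneq.
pose R := S :\: [set x; y].
have sep_x : y \notin component R x := ends_separated crit trP bS cb aS eba.
have sep_y : x \notin component R y by rewrite comp_sym.
have sRS : R \subset S by apply: subsetDl.
have tail_trace v Q : traces (v :: Q) S -> traceable (S :\ v).
  move=> [sQ /= /andP[vQ uniqQ] memQ]; exists Q; split=> //; first exact: path_sorted sQ.
  by move=> z; rewrite in_setD1 -memQ inE; case: eqVneq => [->|] //=; apply: negbTE.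
have big_end v Q : v \in [set x; y] -> traces (v :: Q) S -> c <= #|component R v|.
  move=> vxy trQ; have vS : v \in S by case: trQ => _ _ <-; apply: mem_head.
  apply: leq_trans (critical_shrink crit vS (tail_trace v Q trQ)) _.
  apply/subset_leq_card/comp_sub/subsetP=> z /setDP[zS zxy].
  by rewrite in_setD1 zS andbT; apply: contraNneq zxy => ->.
have le_c : {in ~: S, forall a, #|component S a| <= c}.
  by move=> d; rewrite inE; apply: critical_le crit d.
have Cx : c <= #|component R x| by apply: big_end trP; rewrite !inE eqxx.
have Cy : c <= #|component R y| by apply: big_end trP'; rewrite !inE eqxx orbT.
have [px [A [X [sAC cA sideA]]]] := end_region xS xy sep_x le_c c_gt0 Cx.
have Ryx : S :\: [set y; x] = R by rewrite setUC.
have yx : y != x by rewrite eq_sym.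
have := end_region (w := x) yS yx; rewrite Ryx => /(_ c sep_y le_c c_gt0 Cy).
case=> py [B [Y [sBC cB sideB]]].
pose K := (if px then [::] else [:: x]) ++ M ++ (if py then [::] else [:: y]).
have perm_P : perm_eq (x :: rcons M y)
    ((if px then [:: x] else [::]) ++ (if py then [:: y] else [::]) ++ K).
  rewrite /K -cats1; case: (px) (py) => [] [] /=; rewrite ?cats0 ?perm_cons ?perm_refl //.
  - by rewrite perm_catC.
  by rewrite -cat_cons perm_catC.
have memS z : (z \in S) = [|| z == x, z == y | z \in M] by rewrite -memP inE mem_rcons inE.
have memK z : (z \in K) = [&& z \in S, ~~ (px && (z == x)) & ~~ (py && (z == y))].
  have xM : (z == x) ==> (z \notin M).
    apply/implyP=> /eqP->; move: uP; rewrite /= mem_rcons inE negb_or => /andP[/andP[_ ->]].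
    by [].
  have yM : (z == y) ==> (z \notin M).
    by apply/implyP=> /eqP->; move: uP; rewrite /= rcons_uniq => /and3P[].
  have zxy : ~~ ((z == x) && (z == y)) by apply: contra xy => /andP[/eqP<- /eqP<-].
  rewrite memS /K !mem_cat; move: xM yM zxy.
  by case: (px) (py) => [] []; rewrite ?inE; case: (z == x); case: (z == y); case: (z \in M).
pose KS := [set z in K].
have inKS z : (z \in KS) = [&& z \in S, ~~ (px && (z == x)) & ~~ (py && (z == y))].
  by rewrite inE memK.
have sRK : R \subset KS.
  apply/subsetP=> z; rewrite inKS !inE negb_or => /andP[/andP[/negPf-> /negPf->] ->].
  by rewrite !andbF.
have sKS : KS \subset S by apply/subsetP=> z; rewrite inKS => /andP[].
have xK : (x \in KS) = ~~ px by rewrite inKS xS eqxx (negPf xy) andbF !andbT.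
have yK : (y \in KS) = ~~ py by rewrite inKS yS eqxx (negPf yx) andbF !andbT.
have [stA startA] := region_stable xS sep_x sRK sKS xK sAC sideA.
have [stB startB] : stable KS B /\ {in B, forall a, exists2 z, z \in Y & z \in component KS a}.
  by apply: (@region_stable S KS y x py); rewrite ?Ryx.
have disAB : [disjoint A & B].
  apply/pred0P=> z; apply/negP=> /andP[/(subsetP sAC) zx /(subsetP sBC) zy].
  by case/negP: sep_x; rewrite -(comp_eq zx) comp_sym.
(* An end adjacent to the component of [b] could be extended into it. *)
have far_b v Q : traces (v :: Q) S -> v \in [set x; y] -> [disjoint component S b & component R v].
  move=> trQ vxy; apply/pred0P=> z; apply/negP=> /andP[zb zv].
  have bv : connect (avoid R) b v.
    suff : v \in component R b by rewrite inE.
    by rewrite -(comp_eq (subsetP (comp_sub b sRS) z zb)) comp_sym.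
  have vS : v \in S by case: trQ => _ _ <-; apply: mem_head.
  have vb : v \notin component S b by apply: contraL vS; apply: comp_notin.
  have [p [q [pC qC /and3P[pR qR epq]]]] := connect_exit bv (comp_refl S b) vb.
  have pS := comp_notin bS pC.
  have cp : #|component S p| = c by rewrite (comp_eq pC).
  have qS : q \in S.
    by apply: contraR qC => qS; apply: comp_step pC _; rewrite /avoid /= pS qS.
  move: qR; rewrite !inE qS andbT negbK => /orP[/eqP qx | /eqP qy].
    by have := end_far crit trP pS cp; rewrite -qx epq.
  by have := end_far crit trP' pS cp; rewrite -qy epq.
have Ab : [disjoint component S b & A].
  rewrite disjoint_sym; apply: disjointWl sAC _; rewrite disjoint_sym.
  by apply: far_b trP _; rewrite !inE eqxx.
have Bb : [disjoint component S b & B].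
  rewrite disjoint_sym; apply: disjointWl sBC _; rewrite disjoint_sym.
  by apply: far_b trP' _; rewrite !inE eqxx orbT.
exists c, K, A, B, X, Y; split=> //.
- split=> //.
  have := perm_uniq perm_P; rewrite uP catA cat_uniq => /esym/and3P[_ _ //].
- split=> //.
    apply: leq_trans (_ : #|component S b :|: (A :|: B)| <= _); last first.
      apply/subset_leq_card/subsetP=> z; rewrite in_setC => /setUP[zb | /setUP[zA | zB]].
      - by apply: contra (comp_notin bS zb); apply: (subsetP sKS).
      - exact: stA.1.
      exact: stB.1.
    have dis0 (U V : {set T}) : [disjoint U & V] -> #|U :|: V| = #|U| + #|V|.
      by move=> dUV; rewrite cardsU disjoint_setI0 // cards0 subn0.
    rewrite dis0; last by rewrite -setI_eq0 setIUr setU_eq0 !setI_eq0 Ab.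
    rewrite dis0 // cb 2!mulSn mul1n leq_add2l; case/andP: cA => cA _.
    by case/andP: cB => cB _; apply: leq_add.
  move=> d; rewrite in_setC !inE !negb_or -/KS => /andP[/andP[dK dA] dB].
  have xA : px -> x \in A by move=> pxT; move: sideA; rewrite pxT => -[-> _]; apply: comp_refl.
  have yB : py -> y \in B by move=> pyT; move: sideB; rewrite pyT => -[-> _]; apply: comp_refl.
  (* A popped end belongs to its region, so a vertex outside the regions has
     the same component outside the core path as outside [S]. *)
  have popped v : v \in S -> v \notin KS -> v \in A \/ v \in B.
    move=> vS; rewrite inKS vS /= negb_and !negbK.
    by case/orP=> /andP[? /eqP->]; [left; apply: xA | right; apply: yB].
  have dS : d \notin S.
    by apply/negP=> /popped[|dA'|dB']; [rewrite inE | rewrite dA' in dA | rewrite dB' in dB].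
  rewrite (comp_same sKS dS); first by apply: le_c; rewrite inE.
  move=> v; rewrite inE => /andP[vK vS]; rewrite comp_sym; apply/negP=> dv.
  have [vA | vB] := popped v vS vK; first by rewrite (comp_in stA vA dv) in dA.
  by rewrite (comp_in stB vB dv) in dB.
have defX : X = (if px then [set x] else nbhd x) by case: (px) sideA => -[].
have defY : Y = (if py then [set y] else nbhd y) by case: (py) sideB => -[].
move=> P1 Q sP1 sQ hP hQ.
have := join_left defX sP sP1 hP; set H := rev P1 ++ _ => sH.
have [H' def_H] : exists H', H = rcons H' y.
  by exists (rev P1 ++ (if px then [::] else [:: x]) ++ M); rewrite /H !rcons_cat.
have := join_left defY (K' := rev H') _ sQ hQ.
rewrite -rev_rcons -def_H sorted_rev => /(_ sH); rewrite -sorted_rev.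
congr (is_true (sorted e _)).
have -> : H' = rev P1 ++ (if px then [::] else [:: x]) ++ M.
  by move: def_H; rewrite /H -!rcons_cat => /rcons_inj[].
by rewrite !rev_cat !revK /K -!catA; case: (py).
Qed.

End Graph.

(** * Joining the core path with the links *)

Section Assembly.

Variables (T : finType) (e : rel T).
Hypothesis e_sym : symmetric e.

Implicit Types (A B E L R X Y W : seq T) (ss : seq (seq T)).

(** Either some cut falls inside [X] or just before it, and the first such cut
    is chosen, so that a single piece contains all of [X] up to the cut; or
    [X] lies inside one piece that begins before [X] does or is the first. *)
Lemma first_cut ss L X E : flatten ss = L ++ X ++ E -> X != [::] ->
  (exists s1 l X1 X2 s2, [/\ ss = s1 ++ (l ++ X1) :: s2, X = X1 ++ X2,
     flatten s1 ++ l = L & flatten s2 = X2 ++ E]) \/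
  (exists s1 a b s2, [/\ ss = s1 ++ (a ++ X ++ b) :: s2, flatten s1 ++ a = L
     & a != [::] \/ s1 = [::]]).
Proof.
elim: ss L => [|s ss IH] L /=; first by case: L => //; case: X.
case/cat_cases=> [[u [-> fl]] | [u [-> fl]]] X0; last first.
  move: fl => /cat_cases[[w [-> def_E]] | [w [def_X fl]]].
    by right; exists [::], L, w, ss; split=> //; right.
  by left; exists [::], L, u, w, ss.
have [u0 | u0] := eqVneq u [::].
  by left; exists [::], s, [::], X, ss; rewrite fl u0 !cats0.
have [[s1 [l [X1 [X2 [s2 [-> -> <- fl2]]]]]] | [s1 [a [b [s2 [-> def_u a0]]]]]] := IH u fl X0.
  by left; exists (s :: s1), l, X1, X2, s2; rewrite /= catA.
right; exists (s :: s1), a, b, s2; rewrite /= -catA def_u; split=> //; left.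
by case: a0 => // s10; rewrite -def_u s10 in u0.
Qed.

(** The variant for cuts inside [Y] or just after it. *)
Lemma first_cut_right ss E Y R : flatten ss = E ++ Y ++ R -> Y != [::] ->
  (exists t1 l Y1 Y2 t2, [/\ ss = t1 ++ (l ++ Y1) :: t2, Y = Y1 ++ Y2,
     flatten t1 ++ l = E, flatten t2 = Y2 ++ R & t2 != [::]]) \/
  (exists t1 a b t2, [/\ ss = t1 ++ (a ++ Y ++ b) :: t2, R = b ++ flatten t2
     & b != [::] \/ t2 = [::]]).
Proof.
move=> + Y0; elim: ss E => [|s ss IH] E /=; first by case: E => //; case: (Y) Y0.
have next u : E = s ++ u -> flatten ss = u ++ Y ++ R ->
  (exists t1 l Y1 Y2 t2, [/\ s :: ss = t1 ++ (l ++ Y1) :: t2, Y = Y1 ++ Y2,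
     flatten t1 ++ l = E, flatten t2 = Y2 ++ R & t2 != [::]]) \/
  (exists t1 a b t2, [/\ s :: ss = t1 ++ (a ++ Y ++ b) :: t2, R = b ++ flatten t2
     & b != [::] \/ t2 = [::]]).
  move=> -> /IH[[t1 [l [Y1 [Y2 [t2 [-> -> <- fl2 t20]]]]]] | [t1 [a [b [t2 [-> -> b0]]]]]].
    by left; exists (s :: t1), l, Y1, Y2, t2; rewrite /= catA.
  by right; exists (s :: t1), a, b, t2.
case/cat_cases=> [[u []] | [u [def_s fl]]]; first exact: next.
move: fl => /cat_cases[[w [def_u def_R]] | [w [def_Y fl]]].
  have [ss0 | ss0] := eqVneq ss [::].
    by right; exists [::], E, w, ss; rewrite def_s def_u; split=> //; right.
  have [w0 | w0] := eqVneq w [::].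
    left; exists [::], E, Y, [::], ss.
    by rewrite def_s def_u w0 def_R w0 !cats0.
  by right; exists [::], E, w, ss; rewrite def_s def_u; split=> //; left.
have [ss0 | ss0] := eqVneq ss [::].
  move: fl; rewrite ss0 => /esym/eqP; rewrite -size_eq0 size_cat addn_eq0 !size_eq0.
  case/andP=> /eqP w0 /eqP R0; right; exists [::], E, [::], [::].
  by rewrite def_s def_Y w0 R0 !cats0; split=> //; right.
by left; exists [::], E, u, w, ss; rewrite def_s.
Qed.

Lemma links_rcons ss s : links (rcons ss s) [::] = rcons (links ss s) [::].
Proof. by rewrite -cats1 links_cat /= filter_none // !cats0 cats1. Qed.

(** The value [v] forces a cut inside [Wa]: if [Wa] has more than [v] pairs,
    no piece contains it, and if [v] lies between [pairs L] and
    [pairs L + pairs Wa], the first piece neither ends before [L] does nor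
    contains [L ++ Wa].  The piece ending at
    the first such cut has the whole stack of [Wa] as its link, since all
    letters of [L] are closed there.  The same holds for [Wb] from the right,
    and the last, empty link makes room for the joined path. *)
Lemma joined_paths k v ss K L M R Wa Wb (X Y : {set T}) :
    size ss = k.+3 -> flatten ss = L ++ Wa ++ M ++ Wb ++ R ->
    all (fun s => pairs s == v) ss ->
    tour e (L ++ Wa ++ M ++ Wb ++ R) ->
    paired L -> paired Wa -> paired M -> paired Wb -> paired R ->
    pairs L <= v < pairs L + pairs Wa \/ v < pairs Wa ->
    pairs R <= v < pairs R + pairs Wb \/ v < pairs Wb ->
    starts_in X Wa -> starts_in Y Wb ->
    (forall P Q, sorted e P -> sorted e Q ->
       (forall z r, P = z :: r -> z \in X) -> (forall z r, Q = z :: r -> z \in Y) ->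
     sorted e (rev P ++ K ++ Q)) ->
  exists ps, [/\ size ps = k.+1, all (sorted e) ps
    & perm_eq (flatten ps) (K ++ flatten (links ss [::]))].
Proof.
move=> sz_ss fl_ss eq_v tW pL pWa pM pWb pR savedL savedR stX stY joins.
have dW : doubled (L ++ Wa ++ M ++ Wb ++ R) by case: tW.
have dWa_ : doubled (Wa ++ M ++ Wb ++ R).
  by apply: (doubled_cat (A := L) (B := [::])); rewrite cats0.
have dM_ : doubled (M ++ Wb ++ R).
  by apply: (doubled_cat (A := Wa) (B := [::])); rewrite cats0.
have dWb_ : doubled (Wb ++ R).
  by apply: (doubled_cat (A := M) (B := [::])); rewrite cats0.
have disL := paired_disjoint dW pL; have disWa := paired_disjoint dWa_ pWa.
have disM := paired_disjoint dM_ pM; have disWb := paired_disjoint dWb_ pWb.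
have eq_vP s : s \in ss -> pairs s = v by move/(allP eq_v)/eqP.
have Wa0 : Wa != [::] by apply/eqP=> W0; rewrite W0 pairs_nil in savedL; case: savedL; lia.
have Wb0 : Wb != [::] by apply/eqP=> W0; rewrite W0 pairs_nil in savedR; case: savedR; lia.
have [|] := first_cut fl_ss Wa0; last first.
  case=> s1 [a [b [s2 [def_ss def_L a0]]]].
  have piece_in : a ++ Wa ++ b \in ss by rewrite def_ss mem_cat mem_head orbT.
  have := pairs_sub a Wa b; rewrite (eq_vP _ piece_in) => le_v.
  case: savedL => [/andP[leLv ltLv] | ]; last by rewrite ltnNge le_v.
  case: s1 def_ss def_L a0 => [|s s1] def_ss def_L a0.
    rewrite /= in def_L; rewrite def_L in piece_in; have := pairs_sub [::] (L ++ Wa) b.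
    have dLWa : doubled (L ++ Wa).
      by apply: (doubled_cat (A := [::]) (B := M ++ Wb ++ R)); rewrite /= -catA.
    by rewrite /= -catA (eq_vP _ piece_in) (pairs_cat_paired dLWa pL) leqNgt ltLv.
  have s_in : s \in ss by rewrite def_ss mem_head.
  have def_L' : L = s ++ (flatten s1 ++ a) by rewrite -def_L /= catA.
  have dL : doubled L by apply: (doubled_cat (A := [::])); exact: dW.
  suff : pairs s < pairs L by rewrite (eq_vP _ s_in) ltnNge leLv.
  rewrite def_L'; apply: pairs_prefix; rewrite -?def_L' //.
  by case: a0 => // a0; rewrite -size_eq0 size_cat addn_eq0 !size_eq0 negb_and a0 orbT.
case=> s1 [l [X1 [X2 [s2 [def_ss def_Wa def_L fl_s2]]]]].
have fl_s2' : flatten s2 = (X2 ++ M) ++ Wb ++ R by rewrite fl_s2 catA.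
have [|] := first_cut_right fl_s2' Wb0; last first.
  case=> t1 [a [b [t2 [def_s2 def_R b0]]]].
  have piece_in : a ++ Wb ++ b \in ss by rewrite def_ss def_s2 mem_cat inE mem_cat mem_head !orbT.
  have := pairs_sub a Wb b; rewrite (eq_vP _ piece_in) => le_v.
  case: savedR => [/andP[leRv ltRv] | ]; last by rewrite ltnNge le_v.
  case/lastP: t2 def_s2 def_R b0 => [|t2 t] def_s2 def_R b0.
    rewrite cats0 in def_R; have := pairs_sub a (Wb ++ b) [::].
    rewrite !cats0 (eq_vP _ piece_in) -def_R (pairs_cat_paired dWb_ pWb).
    by rewrite leqNgt addnC ltRv.
  have t_in : t \in ss.
    by rewrite def_ss def_s2 mem_cat inE mem_cat inE mem_rcons mem_head !orbT.
  have def_R' : R = (b ++ flatten t2) ++ t by rewrite def_R flatten_rcons catA.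
  have dR : doubled R by apply: (doubled_cat (A := Wb) (B := [::])); rewrite cats0.
  suff : pairs t < pairs R by rewrite (eq_vP _ t_in) ltnNge leRv.
  rewrite def_R'; apply: pairs_suffix; rewrite -?def_R' //.
  case: b0 => [b0|]; last by case: (t2).
  by rewrite -size_eq0 size_cat addn_eq0 !size_eq0 negb_and b0.
case=> t1 [m [Y1 [Y2 [t2 [def_s2 def_Wb def_M fl_t2 t20]]]]].
pose Qx := [seq z <- X1 | z \in X2]; pose Qy := [seq z <- Y1 | z \in Y2].
have link_x : [seq z <- l ++ X1 | z \in flatten s2] = Qx.
  rewrite fl_s2 stack_cat_right.
    apply: stack_cat_left => z zX1; apply: disWa; rewrite def_Wa mem_cat zX1 //.
  move=> z zl; have /disL : z \in L by rewrite -def_L mem_cat zl orbT.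
  by rewrite def_Wa -!catA mem_cat negb_or => /andP[].
have link_y : [seq z <- m ++ Y1 | z \in flatten t2] = Qy.
  rewrite fl_t2 stack_cat_right.
    by apply: stack_cat_left => z zY1; apply: disWb; rewrite def_Wb mem_cat zY1.
  move=> z zm; have : z \in X2 ++ M by rewrite -def_M mem_cat zm orbT.
  rewrite mem_cat => /orP[zX2 | zM].
    have /disWa : z \in Wa by rewrite def_Wa mem_cat zX2 orbT.
    by rewrite def_Wb -!catA !mem_cat !negb_or => /and4P[_ _ -> ->].
  by have := disM z zM; rewrite def_Wb -!catA mem_cat negb_or => /andP[].
case/lastP: t2 => [|t2 t] // in def_s2 fl_t2 t20 link_y *.
have def_links : links ss [::] = links s1 (flatten ((l ++ X1) :: s2)) ++
    Qx :: links t1 (flatten ((m ++ Y1) :: rcons t2 t)) ++ Qy :: rcons (links t2 t) [::].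
  by rewrite def_ss links_cat /= !cats0 link_x def_s2 links_cat /= !cats0 link_y links_rcons.
have := @links_sorted _ e ss [::] [::]; rewrite /= cats0 fl_ss => /(_ tW).
rewrite def_links !all_cat /= all_cat /= all_rcons.
case/and3P=> sorted1 sorted_x /and3P[sorted2 sorted_y /andP[_ sorted3]].
exists ((rev Qx ++ K ++ Qy) :: links s1 (flatten ((l ++ X1) :: s2)) ++
  links t1 (flatten ((m ++ Y1) :: rcons t2 t)) ++ links t2 t); split.
- move: sz_ss; rewrite def_ss def_s2 /= !size_cat !size_links /= size_cat /= size_rcons.
  by clear; lia.
- rewrite /= !all_cat sorted1 sorted2 sorted3 !andbT; apply: joins => // z r.
    exact: stX def_Wa.
  exact: stY def_Wb.
apply/permP=> p; rewrite /= !flatten_cat /= ?flatten_cat /= ?flatten_rcons /=.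
rewrite !count_cat count_rev /= addn0.
move: (count p K) (count p Qx) (count p Qy) (count p (flatten (links s1 _))).
by move: (count p (flatten (links t1 _))) (count p (flatten (links t2 _))); clear; lia.
Qed.

(** A letter has at most two occurrences, so it is counted in one piece. *)
Lemma card_inner_pieces ss (v : nat) : doubled (flatten ss) -> all (fun s => pairs s == v) ss ->
  #|[set z | has (fun s => z \in inner s) ss]| = size ss * v.
Proof.
elim: ss => [|s ss IH] /= dW.
  by move=> _; apply/eqP; rewrite cards_eq0 -subset0; apply/subsetP=> z; rewrite !inE.
have dss : doubled (flatten ss) by apply: (doubled_cat (A := s) (B := [::])); rewrite cats0.
case/andP=> /eqP sv eq_ss; rewrite mulSn -(IH dss eq_ss) -sv -cardsUI (_ : _ :&: _ = set0) ?cards0 ?addn0.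
  by congr #|pred_of_set _|; apply/setP=> z; rewrite !inE.
apply/setP=> z; rewrite in_setI in_set0 in_set; apply/negP=> /andP[zs /has_inner zss].
by have := dW z; move: zs; rewrite inE occ_cat; lia.
Qed.

(** The whole construction for an abstract graph; the bins of the pieces will
    be the parts of the multipartite graph. *)
Lemma paths_and_pieces k : (forall x y, connect e x y) ->
  exists ps ss v,
   [/\ [/\ size ps = k.+1, all (sorted e) ps & uniq (flatten ps)],
       [/\ size ss = k.+3, all (fun s => pairs s == v) ss & tour e (flatten ss)]
     & forall z, (z \in flatten ps) = ~~ has (fun s => z \in inner s) ss].
Proof.
have flatten_nil n : flatten (nseq n [::]) = [::] :> seq T by elim: n.
case/(core_path e_sym)=> [[P [sP uP memP]] |].
  exists (P :: nseq k [::]), (nseq k.+3 [::]), 0; split.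
  - by rewrite /= size_nseq sP all_nseq orbT flatten_nil cats0.
  - rewrite size_nseq all_nseq pairs_nil orbT flatten_nil; split=> //.
    by split=> [//|[] // [] // _ z z'|[] // [] //]; rewrite inE.
  move=> z; rewrite /= flatten_nil cats0 memP inE has_nseq.
  by rewrite !inE !andbF.
case=> c [K [A [B [X [Y [[uK stA stB disAB] [cA cB c3 le_c] startA startB joins]]]]]].
set S := [set z in K] in stA stB c3 le_c startA startB.
have [Wa [tWa spA stX]] := tour_exists e_sym stA startA.
have [Wb [tWb spB stY]] := tour_exists e_sym stB startB.
have stD : stable e S (~: (S :|: A :|: B)).
  split=> [a|a b]; rewrite !in_setC !in_setU !negb_or; first by case/andP=> /andP[].
  case/andP=> /andP[aS aA] aB ab; have /and3P[_ bS _] := ab.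
  have ba : avoid e S b a by rewrite avoid_sym.
  by rewrite bS (contra (fun bA => stA.2 b a bA ba)) // (contra (fun bB => stB.2 b a bB ba)).
have [bs [sp_bs t_bs c_bs cl_bs]] := blocks_exist e_sym stD le_c.
(* The tours of [A], of [B] and of the other components together record
   the complement of the core path. *)
have occ_all z : occ z (Wa ++ Wb ++ flatten bs) = (z \in ~: S).*2.
  rewrite !occ_cat spA spB sp_bs !in_setC !in_setU !negb_or.
  have AS : (z \in A) ==> (z \notin S) by apply/implyP/stA.1.
  have BS : (z \in B) ==> (z \notin S) by apply/implyP/stB.1.
  move: AS BS (pred0P disAB z) => /=.
  by case: (z \in A); case: (z \in B); case: (z \in S).
have dF : doubled (Wa ++ Wb ++ flatten bs) by move=> z; rewrite occ_all; case: (_ \in _).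
have total : pairs (Wa ++ Wb ++ flatten bs) = #|~: S| by rewrite /pairs (spans_inner occ_all).
have [pWa pWb] := (spans_paired spA, spans_paired spB).
have pa : pairs Wa = #|A| by rewrite /pairs (spans_inner spA).
have pb : pairs Wb = #|B| by rewrite /pairs (spans_inner spB).
have p_bs : {in bs, forall b, paired b} by move=> b /t_bs[].
have [bs0 bs_le] : {in bs, forall b, b != [::]} /\ {in bs, forall b, pairs b <= c}.
  by split=> b /c_bs[].
have [cA1 cA2] : c <= pairs Wa /\ pairs Wa < 2 * c by rewrite pa; apply/andP.
have [cB1 cB2] : c <= pairs Wb /\ pairs Wb < 2 * c by rewrite pb; apply/andP.
rewrite -total in c3.
have [L [M [R [v [pbs [ss [sz_ss fl_ss eq_v]] balance]]]]] :=
  arrange_exists dF pWa pWb p_bs bs0 bs_le cA1 cB1 k cA2 cB2 c3.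
have dW : doubled (flatten ss) by rewrite fl_ss; apply: doubled_line dF _ _ _ pbs.
have mem_bs b : b \in L ++ M ++ R -> b \in bs by rewrite (perm_mem pbs).
have occ_ss z : occ z (flatten ss) = (z \in ~: S).*2.
  by rewrite fl_ss /occ (permP (line_perm Wa Wb pbs)); apply: occ_all.
have pW : paired (flatten ss) := spans_paired occ_ss.
have fl_line : line Wa Wb L M R = flatten (L ++ Wa :: M ++ Wb :: R).
  by rewrite !flatten_cat /= flatten_cat.
have tW : tour e (flatten ss).
  rewrite fl_ss fl_line in dW occ_ss *.
  have mem_seq b : b \in L ++ Wa :: M ++ Wb :: R -> [\/ b = Wa, b = Wb | b \in bs].
    rewrite mem_cat inE mem_cat inE => memb.
    have [-> | bWa] := eqVneq b Wa; first by constructor 1.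
    have [-> | bWb] := eqVneq b Wb; first by constructor 2.
    constructor 3; apply: mem_bs; rewrite !mem_cat.
    by rewrite (negPf bWa) (negPf bWb) in memb.
  apply: tour_flatten => // b /mem_seq[-> | -> | b_bs]; try by split.
  - exact: t_bs.
  - move=> z z'; rewrite (spans_mem _ occ_ss) !(spans_mem _ spA) in_setC => zA z'S ezz'.
    by apply: (stA.2 z z' zA); rewrite /avoid /= (stA.1 z zA) z'S.
  - move=> z z'; rewrite (spans_mem _ occ_ss) !(spans_mem _ spB) in_setC => zB z'S ezz'.
    by apply: (stB.2 z z' zB); rewrite /avoid /= (stB.1 z zB) z'S.
  move=> z z' zb; rewrite (spans_mem _ occ_ss) in_setC => z'S ezz'.
  apply: (cl_bs b b_bs z z' zb); rewrite /avoid /= z'S ezz' !andbT.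
  have : z \in flatten bs by apply/flattenP; exists b.
  by rewrite (spans_mem _ sp_bs) => /(stD.1 z).
have mem_K z : (z \in K) = (z \notin flatten ss).
  by rewrite (spans_mem _ occ_ss) in_setC negbK inE.
have uKl : uniq (K ++ flatten (links ss [::])).
  rewrite cat_uniq uK links_uniq ?cats0 // andbT; apply/hasPn=> z.
  by rewrite mem_links // mem_K negbK => /andP[].
have mem_Kl z : (z \in K ++ flatten (links ss [::])) = ~~ has (fun s => z \in inner s) ss.
  rewrite mem_cat mem_links // mem_K; case: (boolP (z \in _)) => //= zW.
  by apply/esym/negP=> /has_inner; move: zW; rewrite mem_occ; case: occ.
(* If the bins exhaust the complement of [K], all links are empty. *)
case: balance => [total_v | [[ltA ltB leLR leRL] savedL savedR]].
  exists (K :: nseq k [::]), ss, v; rewrite /= size_nseq all_nseq flatten_nil cats0 orbT uK.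
  split=> //; first by have := joins [::] [::]; rewrite cats0 => ->.
  move=> z; rewrite -mem_Kl mem_cat mem_links // orbC; case: andP => // -[zW no_piece].
  have : [set z | has (fun s => z \in inner s) ss] = ~: S.
    apply/eqP; rewrite eqEcard (card_inner_pieces dW eq_v) sz_ss total_v total leqnn andbT.
    apply/subsetP=> y; rewrite inE => /has_inner y2; rewrite -(spans_mem _ occ_ss) mem_occ.
    exact: ltnW.
  by move/setP/(_ z); rewrite inE (negPf no_piece) -(spans_mem _ occ_ss) zW.
have p_sub ls : {subset ls <= L ++ M ++ R} -> paired (flatten ls).
  by move=> sub; apply: paired_flatten => b /sub/mem_bs/p_bs.
have pL : paired (flatten L) by apply: p_sub => b bL; rewrite mem_cat bL.
have pM : paired (flatten M) by apply: p_sub => b bM; rewrite !mem_cat bM orbT.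
have pR : paired (flatten R) by apply: p_sub => b bR; rewrite !mem_cat bR !orbT.
have tW' := tW; rewrite fl_ss in tW'.
have inL : pairs (flatten L) <= v < pairs (flatten L) + pairs Wa \/ v < pairs Wa.
  by case: savedL; [left; apply/andP | right].
have inR : pairs (flatten R) <= v < pairs (flatten R) + pairs Wb \/ v < pairs Wb.
  by case: savedR; [left; apply/andP | right].
have [ps [sz_ps sorted_ps perm_ps]] :=
  joined_paths sz_ss fl_ss eq_v tW' pL pWa pM pWb pR inL inR stX stY joins.
exists ps, ss, v; split=> // [|z]; first by split=> //; rewrite (perm_uniq perm_ps).
by rewrite (perm_mem perm_ps).
Qed.

End Assembly.

(** * The parts of the cover as indexed families *)

Lemma flatten_two (T : finType) (ss : seq (seq T)) i j : i < j < size ss ->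
  exists A B C, flatten ss = A ++ nth [::] ss i ++ B ++ nth [::] ss j ++ C.
Proof.
case/andP=> lt_ij lt_j; exists (flatten (take i ss)).
exists (flatten (take (j - i.+1) (drop i.+1 ss))), (flatten (drop j.+1 ss)).
rewrite -{1}(cat_take_drop i ss) flatten_cat (drop_nth [::]) ?(ltn_trans lt_ij) //=.
rewrite -{1}(cat_take_drop (j - i.+1) (drop i.+1 ss)) flatten_cat drop_drop subnK //.
by rewrite (drop_nth [::] lt_j).
Qed.

Lemma uniq_flatten_disjoint (T : finType) (ss : seq (seq T)) i j :
  uniq (flatten ss) -> i < j < size ss -> [disjoint nth [::] ss i & nth [::] ss j].
Proof.
move=> uW /flatten_two[A [B [C def_W]]]; apply/pred0P=> z /=; apply/negP=> /andP[].
have : occ z (flatten ss) <= 1 by rewrite /occ count_uniq_mem ?leq_b1.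
by rewrite def_W !occ_cat !mem_occ; lia.
Qed.

(** A vertex with both occurrences in one piece is closed before a vertex of
    a later piece is opened. *)
Lemma pieces_apart (T : finType) (e : rel T) (ss : seq (seq T)) i j :
    tour e (flatten ss) -> i < j < size ss ->
  [disjoint inner (nth [::] ss i) & inner (nth [::] ss j)]
  /\ {in inner (nth [::] ss i) & inner (nth [::] ss j), forall x y, ~~ e x y}.
Proof.
move=> [dW sep _] /flatten_two[A [B [C def_W]]]; split.
  apply/pred0P=> z /=; apply/negP=> /andP[].
  by have := dW z; rewrite def_W !inE !occ_cat; lia.
move=> x y xi yj; apply: (sep (A ++ nth [::] ss i) (B ++ nth [::] ss j ++ C)).
- by rewrite def_W -!catA.
- by have := subsetP (inner_sub A (nth [::] ss i) [::]) x xi; rewrite cats0.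
exact: (subsetP (inner_sub B _ C)).
Qed.

Lemma red_edge_sym n (c : edge_colouring n) : symmetric (red_edge c).
Proof. by move=> x y; rewrite /red_edge eq_sym setUC. Qed.

Theorem corollary1p9 (k n : nat) (c : edge_colouring n) :
  1 <= k ->
  connected_graph (red_edge c) ->
  exists (P : 'I_k -> seq 'I_n) (A : 'I_(k + 2) -> {set 'I_n}),
    [/\ forall i : 'I_k, path_in (red_edge c) (P i),
        balanced_complete_multipartite_in (blue_edge c) A,
        forall i j : 'I_k, i != j -> [disjoint P i & P j],
        forall (i : 'I_k) (j : 'I_(k + 2)), [disjoint P i & A j]
      & forall x : 'I_n,
          (exists i : 'I_k, x \in P i) \/ (exists j : 'I_(k + 2), x \in A j)].
Proof.
case: k => // k _ conn.
have [ps [ss [v [[sz_ps sorted_ps uniq_ps] [sz_ss eq_v tW] mem_ps]]]] :=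
  paths_and_pieces (@red_edge_sym n c) k conn.
have ss_size (j : 'I_(k.+1 + 2)) : j < size ss by rewrite sz_ss (leq_trans (ltn_ord j)) ?addn2.
have ps_size (i : 'I_k.+1) : i < size ps by rewrite sz_ps.
pose P (i : 'I_k.+1) := nth [::] ps i; pose A (j : 'I_(k.+1 + 2)) := inner (nth [::] ss j).
have bins i j : i < j < size ss -> [disjoint inner (nth [::] ss i) & inner (nth [::] ss j)]
    /\ {in inner (nth [::] ss i) & inner (nth [::] ss j), forall x y, ~~ red_edge c x y}.
  exact: pieces_apart.
have dis_A i j : i != j -> [disjoint A i & A j].
  rewrite -val_eqE neq_ltn => /orP[] lt_ij; last rewrite disjoint_sym.
    by case: (bins i j); rewrite ?lt_ij ?ss_size.
  by case: (bins j i); rewrite ?lt_ij ?ss_size.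
exists P, A; split.
- move=> i; rewrite /path_in (allP sorted_ps) ?mem_nth // andbT.
  move: uniq_ps; rewrite -(cat_take_drop i ps) flatten_cat cat_uniq (drop_nth [::]) //=.
  by rewrite cat_uniq => /and3P[_ _ /andP[]].
- split=> //; first by exists v => j; apply/eqP/(allP eq_v); rewrite mem_nth.
  move=> i j neq_ij x y xi yj.
  have xy : x != y.
    by apply/eqP=> xy; have /pred0P/(_ x) := dis_A i j neq_ij; rewrite /= xi xy yj.
  have : ~~ red_edge c x y.
    move: neq_ij; rewrite -val_eqE neq_ltn => /orP[] lt_ij.
      by case: (bins i j) => [|_]; rewrite ?lt_ij ?ss_size //; apply.
    by rewrite red_edge_sym; case: (bins j i) => [|_]; rewrite ?lt_ij ?ss_size //; apply.
  by rewrite /red_edge /blue_edge xy; case: (c _).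
- move=> i j; rewrite -val_eqE neq_ltn => /orP[] lt_ij; last rewrite disjoint_sym.
    by apply: uniq_flatten_disjoint; rewrite // lt_ij ps_size.
  by apply: uniq_flatten_disjoint; rewrite // lt_ij ps_size.
- move=> i j; apply/pred0P=> z; apply/negP=> /andP[/= zi zj].
  have : z \in flatten ps by apply/flattenP; exists (P i); rewrite ?mem_nth.
  by rewrite mem_ps => /hasP; apply; exists (nth [::] ss j); rewrite ?mem_nth.
move=> x; case: (boolP (x \in flatten ps)) => [/flattenP[p /(nthP [::])[i lt_i <-] xi] | ].
  by left; rewrite sz_ps in lt_i; exists (Ordinal lt_i).
rewrite mem_ps negbK => /hasP[s /(nthP [::])[j lt_j <-] xj]; right.
by rewrite sz_ss -[k.+3](addn2 k.+1) in lt_j; exists (Ordinal lt_j).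
Qed.
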